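(* Let $k\ge 2$ and let $H$ be the 3-graph on vertices $0,1,1',2,2',\dots,k,k'$ whose triples are $\{0,i,i'\}$ for $i=1,\dots,k$ and $\{i-2,i-1,i'\}$ for $i=1,\dots,k$, where unprimed indices $i-2,i-1$ are read modulo $k$ in $\{1,\dots,k\}$ (so these triples are $\{k-1,k,1'\},\{k,1,2'\},\{1,2,3'\},\dots,\{k-2,k-1,k'\}$). Then $H$ has $L_k$ spanning trees, where $L_k$ is the $k$-th Lucas number. For odd $k$ the 3-graph $H$ is 3-Pfaffian, and for even $k\ge 4$ it is non-3-Pfaffian. Furthermore, for even $k\ge4$, $H$ is minimal non-3-Pfaffian with respect to deletion and contraction of triples.
   Context: Lucas numbers: $L_1=1$, $L_2=3$, $L_k=L_{k-1}+L_{k-2}$ for $k\ge3$. A 3-graph is $H=(V,\Delta)$ with $\Delta\subseteq\binom V3$ (triples). A cycle is a sequence $a_0,t_1,a_1,\dots,t_\ell,a_\ell=a_0$, $\ell\ge2$, of distinct vertices $a_0,\dots,a_{\ell-1}$ and distinct triples with $a_{i-1},a_i\in t_i$. A spanning tree is a set of triples with no cycle, covering $V$, connected via paths of triples. Identify $V$ with $[N]$ by a linear order; a triple orientation $\omega$ assigns each triple $t=\{i,j,k\}$ a 3-cycle $\sigma(t,\omega)\in\{(i\,j\,k),(j\,i\,k)\}$; for a spanning tree $T$, $\prod_{t\in T}\sigma(t,\omega)$ is an $N$-cycle $(s(1)\cdots s(N))$ and $\mathrm{sgn}(T,\omega)$ is the sign of $s$ (well defined). A 3-graph is 3-Pfaffian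 if some $\omega$ makes $\mathrm{sgn}(T,\omega)$ constant over all spanning trees (vacuously if no spanning tree). Deleting a triple $abc$ gives $H\setminus abc=(V,\Delta\setminus\{abc\})$. Contracting $abc$ gives $H/abc$ on $V\setminus\{b,c\}$ whose triples are the triples of $H$ disjoint from $\{a,b,c\}$ together with the triples of $H$ meeting $\{a,b,c\}$ in exactly one vertex, with that vertex relabelled $a$ (repeated triples identified; triples meeting $\{a,b,c\}$ in two or more vertices are discarded). $H$ is minimal non-3-Pfaffian (w.r.t. deletion and contraction) if $H$ is not 3-Pfaffian but $H\setminus t$ and $H/t$ are 3-Pfaffian for every triple $t$. *)

(* Defs.v *)
From mathcomp Require Import all_boot all_order all_algebra all_fingroup.
From mathcomp Require Import boolp.

Set Implicit Arguments.
Unset Strict Implicit.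
Unset Printing Implicit Defensive.

(* The vertex set is a subset of an ambient finite type, so that a graph and
   its minors live over the same type. *)
Record graph3 (T : finType) := Graph3 {
  vertices : {set T};
  triples : {set {set T}};
  triplesP : forall t : {set T},
    t \in triples -> (t \subset vertices) && (#|t| == 3)
}.

Section ThreeGraphs.
Variable T : finType.
Implicit Types (H : graph3 T) (D S : {set {set T}}).

(* [a i] and [t i] stand for a_i and t_(i+1), for i = 0, ..., l-1; [ordS] is
   the successor modulo l, so that a_l = a_0. *)
Definition has_cycle D : Prop :=
  exists (l : nat) (a : 'I_l -> T) (t : 'I_l -> {set T}),
    [/\ 2 <= l, injective a, injective t &
        forall i, [/\ t i \in D, a i \in t i & a (ordS i) \in t i]].

Definition share_triple D : rel T :=
  fun x y => [exists t in D, (x \in t) && (y \in t)].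

Definition spanning_tree H S : Prop :=
  [/\ S \subset triples H, ~ has_cycle S, cover S = vertices H &
      {in vertices H &, forall x y, connect (share_triple S) x y}].

Definition spanning_trees H : {set {set {set T}}} :=
  [set S | `[< spanning_tree H S >]].

(* The 3-cycle i |-> j |-> k |-> i for distinct i, j, k; in MathComp
   (s * t) x = t (s x). *)
Definition cycle3 (i j k : T) : {perm T} := (tperm i j * tperm i k)%g.

(* Letting i, j, k range over all orderings of a triple yields exactly its two
   3-cycles. *)
Definition orientation H (w : {set T} -> {perm T}) : Prop :=
  forall t, t \in triples H ->
    exists i j k : T, t = [set i; j; k] /\ w t = cycle3 i j k.

(* The order of the factors is the enumeration order of S; when S is a spanning
   tree, neither being an N-cycle nor the sign below depends on it. *)
Definition tree_perm (w : {set T} -> {perm T}) S : {perm T} :=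
  (\prod_(t in S) w t)%g.

(* V is identified with [N] through [enum_val], i.e. through the enumeration
   order of T; another linear order multiplies the signs of all spanning trees
   by one common factor.  The condition on s says that tree_perm w S restricts
   to the N-cycle (s(1) ... s(N)) on V.  The value 0 is a default which is not
   taken when S is a spanning tree.  Since then N is odd, the sign does not
   depend on the choice of s among its cyclic rotations. *)
Definition tree_sgn H (w : {set T} -> {perm T}) S : int :=
  let v := fun i : 'I_#|vertices H| => enum_val i in
  if [pick s : 'S_#|vertices H| |
        [forall i, tree_perm w S (v (s i)) == v (s (ordS i))]] is Some s
  then ((-1) ^+ s)%R else 0%R.

Definition pfaffian3 H : Prop :=
  exists w, orientation H w /\
    forall S1 S2, spanning_tree H S1 -> spanning_tree H S2 ->
      tree_sgn H w S1 = tree_sgn H w S2.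

Lemma delete_proof H (e : {set T}) (t : {set T}) :
  t \in triples H :\ e -> (t \subset vertices H) && (#|t| == 3).
Proof. by case/setD1P=> _ /triplesP. Qed.

Definition delete H (e : {set T}) : graph3 T := Graph3 (@delete_proof H e).

Definition contract_triples H (e : {set T}) (a : T) : {set {set T}} :=
  [set t in triples H | [disjoint t & e]] :|:
  [set a |: (t :\: e) | t in triples H & #|t :&: e| == 1].

Lemma contract_proof H (e : {set T}) (a : T) :
  e \in triples H -> a \in e -> forall t : {set T},
  t \in contract_triples H e a ->
  (t \subset vertices H :\: (e :\ a)) && (#|t| == 3).
Proof.
move=> eH ae t /setUP[|/imsetP[u]]; rewrite inE.
  case/andP=> /triplesP/andP[tV ->] dte; rewrite andbT subsetD tV /=.
  exact: disjointWr (subD1set _ _) dte.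
case/andP=> /triplesP/andP[uV /eqP u3] /eqP ue1 ->.
rewrite cardsU1 !inE ae /= cardsD u3 ue1 andbT.
apply/subsetP=> x /setU1P[->|/setDP[xu xe]]; rewrite !inE.
  by rewrite eqxx /=; case/andP: (triplesP eH) => /subsetP/(_ a ae).
by rewrite (negPf xe) andbF (subsetP uV).
Qed.

(* H / e, where e = {a, b, c} is contracted to its vertex a. *)
Definition contract H (e : {set T}) (a : T)
    (eH : e \in triples H) (ae : a \in e) : graph3 T :=
  Graph3 (contract_proof eH ae).

(* All three choices of the surviving vertex a are required; they give
   isomorphic contractions. *)
Definition minimal_non_pfaffian3 H : Prop :=
  [/\ ~ pfaffian3 H,
      forall e, e \in triples H -> pfaffian3 (delete H e) &
      forall (e : {set T}) (a : T) (eH : e \in triples H) (ae : a \in e),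
        pfaffian3 (contract eH ae)].

End ThreeGraphs.

(* lucas 0 = 2 is the value forced by L_2 = L_1 + L_0. *)
Fixpoint lucas (k : nat) : nat :=
  match k with
  | 0 => 2
  | 1 => 1
  | (k''.+1 as k').+1 => lucas k' + lucas k''
  end.

(* Indices are residues modulo k, so the index k is represented by the element
   0 of 'I_k.  [inl i] is the unprimed vertex i, [inr i] the primed vertex i',
   and None the vertex 0. *)
Definition vtx (k : nat) : finType := option ('I_k + 'I_k)%type.
Definition hub {k : nat} : vtx k := None.
Definition unprimed {k : nat} (i : 'I_k) : vtx k := Some (inl i).
Definition primed {k : nat} (i : 'I_k) : vtx k := Some (inr i).

Definition lucas_triples (k : nat) : {set {set vtx k}} :=
  [set [set hub; unprimed i; primed i] | i : 'I_k] :|: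
  [set [set unprimed (ord_pred (ord_pred i)); unprimed (ord_pred i); primed i]
     | i : 'I_k].

Lemma ord_pred_neq (k : nat) (i : 'I_k) : 2 <= k -> ord_pred i != i.
Proof.
move=> k2; rewrite -val_eqE /=; case: i => [[|i]] /= ik.
  by rewrite add0n modn_small ?prednK // -lt0n -ltnS prednK.
by rewrite modnDr modn_small ?(ltnW ik) // neq_ltn ltnSn.
Qed.

Lemma lucas_triples_proof (k : nat) : 2 <= k -> forall t : {set vtx k},
  t \in lucas_triples k -> (t \subset [set: vtx k]) && (#|t| == 3).
Proof.
move=> k2 t tk; rewrite subsetT /=.
case/setUP: tk => /imsetP[i _ ->]; rewrite setUC cardsU1 cards2 !inE //=.
by rewrite (inj_eq Some_inj) (inj_eq inl_inj) ord_pred_neq.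
Qed.

Definition lucas_graph (k : nat) (k2 : 2 <= k) : graph3 (vtx k) :=
  Graph3 (lucas_triples_proof k2).

(* Main.v *)
Require Import Defs.
From mathcomp Require Import all_boot all_order all_algebra all_fingroup.
From mathcomp Require Import boolp zify.

(* Seen from a chosen root, a spanning tree is built by attaching triples
   (p, c, d) with p present and c, d new.  The product of the 3-cycles (p c d),
   in any order, is conjugate by an even permutation to the product of the
   3-cycles (root c d): inserting the last triple at p or at the root differs by
   conjugation with a power of the product of the others, which is even.  Hence
   the signs of two trees differ by the sign of a permutation carrying the pairs
   (c, d) of one tree to those of the other.

   In the Lucas graph a spanning tree uses, for each i, exactly one of the spoke
   {0, i, i'} and the rim triple {i-2, i-1, i'}.  If Y is the set of the i whose
   spoke is used, the trees correspond to Y = Z/k and to the nonempty Y without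
   two cyclically consecutive elements, so there are as many as there are sets
   without consecutive elements, namely L_k.  In the standard orientation the
   permutation relating Y to Z/k is the rotation i -> i-1 up to an even
   permutation, so the sign of Y relative to Z/k is (-1)^(k-1), and reversing
   triples multiplies it in the obvious way. *)

Set Implicit Arguments.
Unset Strict Implicit.
Unset Printing Implicit Defensive.

(** * Signs of rooted trees *)

Section Cycle3.
Local Open Scope group_scope.
Variable T : finType.
Implicit Types (i j k : T) (s : {perm T}).

Lemma cycle3J i j k s : cycle3 i j k ^ s = cycle3 (s i) (s j) (s k).
Proof. by rewrite conjMg !tpermJ. Qed.

Lemma cycle3_rot i j k : i != j -> i != k -> j != k ->
  cycle3 i j k = cycle3 j k i.
Proof.
move=> ij ik jk; apply/permP=> x; rewrite !permM.
have [->|xi] := eqVneq x i.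
  by rewrite tpermL (tpermD ij) 1?eq_sym // (@tpermD _ j k) // 1?eq_sym // tpermR.
have [->|xj] := eqVneq x j.
  by rewrite tpermR !tpermL tpermD // eq_sym.
rewrite (@tpermD _ i j) 1?eq_sym //.
have [->|xk] := eqVneq x k; first by rewrite !tpermR tpermL.
by rewrite !tpermD // eq_sym.
Qed.

Lemma cycle3_l i j k : i != j -> j != k -> cycle3 i j k i = j.
Proof. by move=> ij jk; rewrite permM tpermL tpermD // eq_sym. Qed.

Lemma cycle3_m i j k : cycle3 i j k j = k.
Proof. by rewrite permM tpermR tpermL. Qed.

Lemma cycle3_r i j k : i != k -> j != k -> cycle3 i j k k = i.
Proof. by move=> ik jk; rewrite permM (tpermD ik jk) tpermR. Qed.

Lemma cycle3D i j k x : x \notin [:: i; j; k] -> cycle3 i j k x = x.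
Proof.
rewrite !inE !negb_or => /and3P[xi xj xk].
by rewrite permM !tpermD // eq_sym.
Qed.

Lemma odd_cycle3 i j k : i != j -> i != k -> odd_perm (cycle3 i j k) = false.
Proof. by move=> ij ik; rewrite odd_permM !odd_tperm ij ik. Qed.

(** Of the six orderings of a triple, three are rotations of (i j k) and three of (i k j). *)
Lemma cycle3_orient (i j k a b c : T) :
  i != j -> i != k -> j != k -> a != b -> a != c -> b != c ->
  [set a; b; c] = [set i; j; k] ->
  cycle3 a b c = cycle3 i j k \/ cycle3 a b c = cycle3 i k j.
Proof.
move=> ij ik jk ab ac bc /setP eqs.
have ai : a \in [set i; j; k] by rewrite -eqs !inE eqxx.
have bi : b \in [set i; j; k] by rewrite -eqs !inE eqxx orbT.
have ci : c \in [set i; j; k] by rewrite -eqs !inE eqxx orbT.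
have [ji ki kj] : [/\ j != i, k != i & k != j] by split; rewrite eq_sym.
have rot := cycle3_rot.
move: ai bi ci ab ac bc; rewrite !inE -!orbA.
case/or3P=> /eqP->; case/or3P=> /eqP->; case/or3P=> /eqP->;
  rewrite ?eqxx //= => _ _ _.
- by left.
- by right.
- by right; rewrite rot.
- by left; rewrite -rot.
- by left; rewrite rot.
- by right; rewrite -rot.
Qed.

End Cycle3.

(** * Products of 3-cycles along a rooted tree *)

Section Grown.
Local Open Scope group_scope.
Variable T : finType.
Implicit Types (r p c d x : T) (l : seq (T * T * T)) (L : seq {perm T}).

Fixpoint verts r l : seq T :=
  if l is (_, c, d) :: l' then c :: d :: verts r l' else [:: r].

(* The head of the list is the triple attached last. *)
Fixpoint grown r l : bool :=
  if l is (p, c, d) :: l' then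
    [&& p \in verts r l', c \notin verts r l', d \notin verts r l', c != d
      & grown r l']
  else true.

Definition cyc (x : T * T * T) := cycle3 x.1.1 x.1.2 x.2.
Definition tset (x : T * T * T) : {set T} := [set x.1.1; x.1.2; x.2].

(** The normal form to which every tree product is conjugated: all parents are moved to the root. *)
Fixpoint star r l : {perm T} :=
  if l is (_, c, d) :: l' then star r l' * cycle3 r c d else 1.

Lemma verts_root r l : r \in verts r l.
Proof. by elim: l => [|[[p c] d] l IH] /=; rewrite !inE ?eqxx // IH !orbT. Qed.

Lemma grown_uniq r l : grown r l -> uniq (verts r l).
Proof.
elim: l => [|[[p c] d] l IH] //= /and5P[_ cl dl cd /IH ->].
by rewrite inE negb_or cd cl dl.
Qed.

Lemma size_verts r l : size (verts r l) = (size l).*2.+1.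
Proof. by elim: l => [|[[p c] d] l IH] //=; rewrite IH. Qed.

Lemma star_fix r l x : x \notin verts r l -> star r l x = x.
Proof.
elim: l => [|[[p c] d] l IH] /=; first by rewrite perm1.
rewrite !inE !negb_or => /and3P[xc xd xl]; rewrite permM IH // cycle3D //.
rewrite !inE !negb_or xc xd !andbT.
by apply: contraNneq xl => ->; apply: verts_root.
Qed.

(** Multiplying by (r c d) inserts c and d into the cycle of [star r l] just before it returns to r,
    so the cycle through r always covers all vertices attached so far. *)
Lemma star_porbit r l x : grown r l -> x \in verts r l ->
  x \in porbit (star r l) r.
Proof.
elim: l x => [|[[p c] d] l IH] x /=; first by rewrite inE => _ /eqP->; apply: porbit_id.
case/and5P=> _ cl dl cd gl; have rl := verts_root r l.
set Q := star r l; set Q' := Q * _.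
have back y z : z \in porbit Q' r -> Q' y = z -> y \in porbit Q' r.
  by rewrite -!eq_porbit_mem => zO yz; rewrite -(porbit_perm Q' 1 y) expg1 yz.
have rc : r != c by apply: contraNneq cl => <-.
have rd : r != d by apply: contraNneq dl => <-.
have dO : d \in porbit Q' r.
  by apply: (back d r); rewrite ?porbit_id // permM star_fix // cycle3_r.
have cO : c \in porbit Q' r.
  by apply: (back c d) => //; rewrite permM star_fix // cycle3_m.
rewrite !inE => /or3P[/eqP->|/eqP->|xl] //.
(* Follow Q from x until it first reaches r. Up to there its values avoid r, c and d, so Q and Q'
   agree; where Q reaches r, Q' goes to c. *)
have /porbitP[n rn] : r \in porbit Q x by rewrite porbit_sym IH.
elim: n x xl rn => [|n IHn] x xl; first by rewrite perm1 => <-; apply: porbit_id.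
rewrite expgS permM => rn.
have yl : Q x \in verts r l.
  by apply: contraLR xl => yl; rewrite -(perm_inj (star_fix yl)) yl.
have [yr|yr] := eqVneq (Q x) r.
  by apply: back cO _; rewrite permM yr cycle3_l //.
apply: back (IHn _ yl rn) _; rewrite permM cycle3D // !inE (negPf yr) /=.
by apply/norP; split; [apply: contraNneq cl|apply: contraNneq dl] => <-.
Qed.

Lemma perm_onX (A : {set T}) (s : {perm T}) n : perm_on A s -> perm_on A (s ^+ n).
Proof.
by move=> sA; elim: n => [|n IH]; rewrite ?expg0 ?perm_on1 // expgS perm_onM.
Qed.

Lemma odd_permX (s : {perm T}) n : odd_perm (s ^+ n) = odd n && odd_perm s.
Proof.
elim: n => [|n IH]; first by rewrite odd_perm1.
by rewrite expgS odd_permM IH /=; case: (odd_perm s); case: (odd n).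
Qed.

Lemma star_on r l : perm_on [set x in verts r l] (star r l).
Proof.
by apply/subsetP=> x; rewrite !inE; apply: contraR => /star_fix ->.
Qed.

Lemma odd_star r l : grown r l -> odd_perm (star r l) = false.
Proof.
elim: l => [|[[p c] d] l IH] /=; first by rewrite odd_perm1.
case/and5P=> _ cl dl cd gl; rewrite odd_permM IH // odd_cycle3 //.
  by apply: contraNneq cl => <-; apply: verts_root.
by apply: contraNneq dl => <-; apply: verts_root.
Qed.

Lemma cyc_on r l : grown r l -> {in (map cyc l), forall s,
  perm_on [set x in verts r l] s}.
Proof.
elim: l => [|[[p c] d] l IH] //= /and5P[pl cl dl cd gl] s.
rewrite inE => /orP[/eqP->|/IH sl].
  apply/subsetP=> x; rewrite !inE; apply: contraR; rewrite !negb_or.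
  case/and3P=> xc xd xl; rewrite /cyc cycle3D // !inE (negPf xc) (negPf xd) !orbF.
  by apply: contraNneq xl => ->.
apply: subset_trans (sl gl) _; apply/subsetP=> x; rewrite !inE => ->.
by rewrite !orbT.
Qed.

(* For the last triple (p c d), P1 (p c d) P2 = P1 P2 (q c d) with q = P2 p;
   q is moved to the root by a power of the star, which is even. *)
Lemma grown_conj r l L : grown r l -> perm_eq L (map cyc l) ->
  exists s, [/\ odd_perm s = false, perm_on [set x in verts r l] s &
                (\prod_(u <- L) u) ^ s = star r l].
Proof.
elim: l L => [|[[p c] d] l IH] L /=.
  move=> _ /perm_nilP->; exists 1; rewrite odd_perm1 big_nil conj1g; split=> //.
  exact: perm_on1.
case/and5P=> pl cl dl cd gl eqL.
have /splitPr defL : cyc (p, c, d) \in L by rewrite (perm_mem eqL) mem_head.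
case: defL eqL => L1 L2; rewrite perm_catC /= perm_cons perm_catC => eqL.
have [s [so sl sL]] := IH _ gl eqL.
have L2on : perm_on [set x in verts r l] (\prod_(u <- L2) u).
  rewrite big_seq; apply: (big_ind (fun u => perm_on [set x in verts r l] u)).
  - exact: perm_on1.
  - exact: perm_onM.
  - by move=> u uL; apply: (cyc_on gl); rewrite -(perm_mem eqL) mem_cat uL orbT.
have notV x : x \notin verts r l -> x \notin [set x in verts r l] by rewrite inE.
rewrite big_cat big_cons /=; set P1 := \prod_(u <- L1) u.
set P2 := \prod_(u <- L2) u in L2on *.
have ->: P1 * (cyc (p, c, d) * P2) = P1 * P2 * cycle3 (P2 p) c d.
  rewrite (conjgC (cyc _)) mulgA /cyc cycle3J /=.
  by rewrite (out_perm L2on (notV _ cl)) (out_perm L2on (notV _ dl)).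
have qV : s (P2 p) \in verts r l.
  have := perm_closed (P2 p) sl; rewrite (perm_closed _ L2on) !inE pl.
  by [].
have /porbitP[n sq] := star_porbit gl qV.
have rl := verts_root r l.
have Von : perm_on [set x in verts r l] (star r l ^- n).
  by apply: perm_onV; apply: perm_onX; apply: star_on.
exists (s * star r l ^- n); split.
- by rewrite odd_permM so odd_permV odd_permX odd_star // andbF.
- apply: subset_trans (perm_onM sl Von) _.
  by apply/subsetP=> x; rewrite !inE => ->; rewrite !orbT.
rewrite big_cat -/P1 -/P2 /= in sL.
rewrite conjgM (conjMg _ _ s) sL cycle3J sq conjMg cycle3J /=.
rewrite (out_perm sl (notV _ cl)) (out_perm sl (notV _ dl)).
rewrite (out_perm Von (notV _ cl)) (out_perm Von (notV _ dl)) permK.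
by congr (_ * _); apply/conjg_fixP/commgP/commuteV/commuteX.
Qed.

End Grown.

(** * Extending permutations along an injection *)

Section Extension.
Local Open Scope group_scope.
Variables (T1 T2 : finType) (f : T1 -> T2).
Hypothesis f_inj : injective f.
Implicit Type s : {perm T1}.

(** Applied to [enum_val], this compares permutations of the vertices with those of their indices;
    applied to [unprimed], it lets permutations of Z/k act on the Lucas graph. *)
Definition extend_fun s y := if [pick x | f x == y] is Some x then f (s x) else y.

Lemma extend_funE s x : extend_fun s (f x) = f (s x).
Proof.
rewrite /extend_fun; case: pickP => [x' /eqP/f_inj->//|/(_ x)].
by rewrite eqxx.
Qed.

Lemma extend_fun_out s y : y \notin codom f -> extend_fun s y = y.
Proof.
rewrite /extend_fun; case: pickP => [x /eqP<-|//]; by rewrite codom_f.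
Qed.

Lemma extend_funK s : cancel (extend_fun s) (extend_fun s^-1).
Proof.
move=> y; have [/codomP[x ->]|yf] := boolP (y \in codom f).
  by rewrite !extend_funE permK.
by rewrite !extend_fun_out.
Qed.

Definition extend s := perm (can_inj (extend_funK s)).

Lemma extendE s x : extend s (f x) = f (s x).
Proof. by rewrite permE extend_funE. Qed.

Lemma extend_out s y : y \notin codom f -> extend s y = y.
Proof. by move=> yf; rewrite permE extend_fun_out. Qed.

Lemma extend1 : extend 1 = 1.
Proof.
apply/permP=> y; have [/codomP[x ->]|yf] := boolP (y \in codom f).
  by rewrite extendE !perm1.
by rewrite extend_out // perm1.
Qed.

Lemma extendM s t : extend (s * t) = extend s * extend t.
Proof.
apply/permP=> y; rewrite permM.
have [/codomP[x ->]|yf] := boolP (y \in codom f).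
  by rewrite !extendE permM.
by rewrite !extend_out.
Qed.

Lemma extend_tperm x y : extend (tperm x y) = tperm (f x) (f y).
Proof.
apply/permP=> z; have [/codomP[u ->]|zf] := boolP (z \in codom f).
  by rewrite extendE inj_tperm.
by rewrite extend_out // tpermD //; apply: contraNneq zf => <-; apply: codom_f.
Qed.

Lemma odd_extend s : odd_perm (extend s) = odd_perm s.
Proof.
have [ts -> tsP] := prod_tpermP s; elim: ts tsP => [_|t ts IH] /=.
  by rewrite !big_nil extend1 !odd_perm1.
case/andP=> t_d /IH ots; rewrite !big_cons extendM !odd_permM ots extend_tperm.
by rewrite !odd_tperm (inj_eq f_inj).
Qed.

Lemma extend_on (s : {perm T2}) :
  perm_on [set y in codom f] s -> exists s1, s = extend s1.
Proof.
move=> sf.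
have sfP x : s (f x) \in codom f.
  by have := perm_closed (f x) sf; rewrite !inE codom_f.
pose g x := iinv (sfP x).
have gE x : f (g x) = s (f x) by apply: f_iinv.
have gI : injective g.
  by move=> x y /(congr1 f); rewrite !gE => /perm_inj/f_inj.
exists (perm gI); apply/permP=> y.
have [/codomP[x ->]|yf] := boolP (y \in codom f).
  by rewrite extendE permE gE.
by rewrite extend_out // (out_perm sf) // inE.
Qed.

End Extension.

(** * Parity of the arrangements of a cycle *)

Section Signs.
Local Open Scope group_scope.
Variable T : finType.
Implicit Types (V : {set T}) (H : graph3 T) (P : {perm T}).

(** The condition on s in [tree_sgn], for an arbitrary permutation P in place of the tree
    product. *)
Definition arranges V P (s : 'S_#|V|) :=
  [forall i, P (enum_val (s i)) == enum_val (s (ordS i))].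

Lemma codom_enum_val V : [set y in codom (@enum_val T (mem V))] = V.
Proof.
apply/setP=> x; rewrite inE; apply/codomP/idP=> [[i ->]|xV].
  exact: enum_valP.
by exists (enum_rank_in xV x); rewrite enum_rankK_in.
Qed.

Lemma iter_ordS n i (j : 'I_n) : iter i (@ordS n) j = (j + i) %% n :> nat.
Proof.
elim: i => [|i IH] /=; first by rewrite addn0 modn_small.
by rewrite IH -addn1 modnDml -addnA addn1.
Qed.

(* Two arrangements of the same cycle differ by a rotation, which is even since
   its order divides the odd number #|V|. *)
Lemma arranges_odd V P s1 s2 : odd #|V| ->
  @arranges V P s1 -> @arranges V P s2 -> odd_perm s1 = odd_perm s2 :> bool.
Proof.
move=> oV /forallP a1 /forallP a2.
have [s1E s2E] : (forall i, P (enum_val (s1 i)) = enum_val (s1 (ordS i)))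
    /\ (forall i, P (enum_val (s2 i)) = enum_val (s2 (ordS i))).
  by split=> i; apply/eqP.
pose r := s1 * s2^-1.
have s1r i : s1 i = s2 (r i) by rewrite permM permKV.
have rS i : r (ordS i) = ordS (r i).
  by apply/(@perm_inj _ s2)/enum_val_inj; rewrite -s1r -s1E s1r s2E.
pose o : 'S_#|V| := perm (@ordS_inj #|V|).
have oE n j : (o ^+ n) j = iter n (@ordS _) j.
  by rewrite permX; apply: eq_iter => ?; rewrite permE.
have o1 : o ^+ #|V| = 1.
  apply/permP=> j; rewrite oE perm1; apply/val_inj.
  by rewrite /= iter_ordS modnDr modn_small.
have oo : odd_perm o = false.
  by move: (congr1 (@odd_perm _) o1); rewrite odd_permX oV odd_perm1.
have V0 : 0 < #|V| by case: #|V| oV.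
pose i0 := Ordinal V0.
have ->: s1 = r * s2 by rewrite mulgKV.
suff ->: r = o ^+ (r i0) by rewrite odd_permM odd_permX oo andbF.
apply/permP=> j; rewrite oE.
have jE : j = iter j (@ordS _) i0.
  by apply/ord_inj; rewrite iter_ordS add0n modn_small.
have rI n : r (iter n (@ordS _) i0) = iter n (@ordS _) (r i0).
  by elim: n => //= n <-.
by rewrite [in LHS]jE rI; apply: ord_inj; rewrite !iter_ordS addnC.
Qed.

(** Conjugating by s relabels the entries of the cycle, so the arrangement is composed with the
    permutation of indices induced by s, which has the sign of s. *)
Lemma arrangesJ V P (s : {perm T}) : perm_on V s ->
  forall s1, @arranges V P s1 ->
  exists2 s2, @arranges V (P ^ s) s2 & odd_perm s2 = odd_perm s1 (+) odd_perm s :> bool.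
Proof.
rewrite -{1}(codom_enum_val V) => /(extend_on (@enum_val_inj T (mem V)))[t ->].
move=> s1 /forallP s1P; exists (s1 * t).
  apply/forallP=> i; rewrite !(permM s1) -!(extendE (@enum_val_inj T (mem V)) t) permJ.
  by rewrite (eqP (s1P i)).
by rewrite odd_permM odd_extend.
Qed.

(** The sequence x, P x, P^2 x, ... lists V without repetition and closes up after #|V| steps. *)
Lemma porbit_arranges V P x : x \in V -> porbit P x = V ->
  exists s, @arranges V P s.
Proof.
move=> xV PV.
have f_mem (i : 'I_#|V|) : (P ^+ i) x \in V by rewrite -{2}PV mem_porbit.
pose f (i : 'I_#|V|) := enum_rank_in xV ((P ^+ i) x).
have fE i : enum_val (f i) = (P ^+ i) x by rewrite enum_rankK_in.
have f_inj : injective f.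
  move=> i j /(congr1 enum_val); rewrite !fE !permX => ij; apply/val_inj/eqP.
  have sz : size (traject P x #|porbit P x|) = #|V| by rewrite size_traject PV.
  rewrite -(nth_uniq x _ _ (uniq_traject_porbit P x)) ?sz ?ltn_ord //.
  by rewrite !nth_traject ?PV ?ltn_ord //= ij.
exists (perm f_inj); apply/forallP=> i; rewrite !permE !fE /= !permX.
have [iV|iV] := ltnP i.+1 #|V|; first by rewrite modn_small.
have ->: i.+1 = #|V| by apply/eqP; rewrite eqn_leq iV ltn_ord.
rewrite modnn /= -iterS.
have ->: i.+1 = #|V| by apply/eqP; rewrite eqn_leq iV ltn_ord.
by rewrite -{1}PV iter_porbit.
Qed.

Lemma tree_sgn_arranges H w S s : odd #|vertices H| ->
  @arranges (vertices H) (tree_perm w S) s -> tree_sgn H w S = ((-1) ^+ odd_perm s)%R.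
Proof.
move=> oH sP; rewrite /tree_sgn; case: pickP => [s' s'P|/(_ s)]; last first.
  by rewrite -/(@arranges (vertices H) _ s) sP.
by rewrite (arranges_odd oH s'P sP).
Qed.

End Signs.

(** * Comparing the signs of two rooted trees *)

Section TreeLists.
Local Open Scope group_scope.
Variable T : finType.
Implicit Types (H : graph3 T) (w : {set T} -> {perm T}) (S : {set {set T}}).
Implicit Types (r : T) (l : seq (T * T * T)).

(* The parent of a triple comes first, and its children are ordered so that
   [cyc] agrees with the orientation w. *)
Definition tree_list H w S r l :=
  [/\ grown r l, verts r l =i vertices H, perm_eq (enum S) (map (@tset T) l) &
      {in l, forall x, w (tset x) = cyc x}].

Lemma tree_list_odd H w S r l : tree_list H w S r l -> odd #|vertices H|.
Proof.
case=> gl vl _ _; rewrite -(eq_card vl) (card_uniqP _) ?grown_uniq //.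
by rewrite size_verts /= odd_double.
Qed.

Lemma tree_perm_star H w S r l : tree_list H w S r l ->
  exists s, [/\ odd_perm s = false, perm_on (vertices H) s &
                 tree_perm w S ^ s = star r l].
Proof.
case=> gl vl pl wl.
pose L := [seq w t | t <- index_enum {set T} & t \in S].
have pL : perm_eq L (map (@cyc T) l).
  have <-: map w (map (@tset T) l) = map (@cyc T) l.
    by rewrite -map_comp; apply/eq_in_map.
  apply/perm_map/(perm_trans _ pl)/uniq_perm => [||t].
  - exact/filter_uniq/index_enum_uniq.
  - exact: enum_uniq.
  - by rewrite mem_filter mem_index_enum andbT.
have [s [so sl sS]] := grown_conj gl pL.
exists s; split=> //.
  by apply: subset_trans sl _; apply/subsetP=> x; rewrite inE vl.
by rewrite -sS big_map big_filter.
Qed.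

(** The star is a single cycle on the vertices, hence so is its conjugate [tree_perm w S]. In
    particular the default value 0 of [tree_sgn] is not reached. *)
Lemma tree_list_arranges H w S r l : tree_list H w S r l ->
  exists s, @arranges T (vertices H) (tree_perm w S) s.
Proof.
move=> tl; have [s [_ sl sS]] := tree_perm_star tl; have [gl vl _ _] := tl.
have rV : r \in vertices H by rewrite -vl verts_root.
have [|s1 s1P] := @porbit_arranges _ (vertices H) (star r l) r rV.
  apply/setP=> x; rewrite -vl; apply/idP/idP=> [/porbitP[n ->]|].
    have on : perm_on (vertices H) (star r l ^+ n).
      apply: perm_onX; apply: subset_trans (star_on r l) _.
      by apply/subsetP=> y; rewrite inE vl.
    by rewrite vl (perm_closed _ on).
  exact: star_porbit.
have [s2 s2P _] := arrangesJ (perm_onV sl) s1P.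
by exists s2; rewrite -sS conjgK in s2P.
Qed.

(** Parents are ignored because the star does not depend on them. *)
Fixpoint renames s l1 l2 : bool :=
  match l1, l2 with
  | (_, c1, d1) :: l1', (_, c2, d2) :: l2' =>
      [&& s c1 == c2, s d1 == d2 & renames s l1' l2']
  | [::], [::] => true
  | _, _ => false
  end.

Lemma star_renames (s : {perm T}) r l1 l2 : s r = r -> renames s l1 l2 ->
  star r l1 ^ s = star r l2.
Proof.
move=> sr; elim: l1 l2 => [|[[p c] d] l1 IH] [|[[p' c'] d'] l2] //=.
  by rewrite conj1g.
by case/and3P=> /eqP<- /eqP<- /IH<-; rewrite conjMg cycle3J sr.
Qed.

(** Even permutations s1, s2 conjugate the two tree products to stars, and s carries one star to the
    other. Hence [s1 * s * s2^-1] conjugates one product to the other, and it has the sign of s. *)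
Lemma tree_sgn_renames H w S1 S2 r l1 l2 (s : {perm T}) :
  tree_list H w S1 r l1 -> tree_list H w S2 r l2 ->
  perm_on (vertices H) s -> s r = r -> renames s l1 l2 ->
  tree_sgn H w S2 = (tree_sgn H w S1 * (-1) ^+ odd_perm s)%R.
Proof.
move=> t1 t2 sH sr sl; have [u1 u1P] := tree_list_arranges t1.
have [s1 [o1 s1H s1S]] := tree_perm_star t1.
have [s2 [o2 s2H s2S]] := tree_perm_star t2.
have oH := tree_list_odd t1.
have sE : tree_perm w S1 ^ (s1 * s * s2^-1) = tree_perm w S2.
  by rewrite !conjgM s1S (star_renames sr sl) -s2S conjgK.
have [|u2] := arrangesJ (_ : perm_on _ (s1 * s * s2^-1)) u1P.
  by rewrite !perm_onM ?perm_onV.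
rewrite sE => u2P o; rewrite (tree_sgn_arranges oH u1P) (tree_sgn_arranges oH u2P).
by rewrite o !odd_permM odd_permV o1 o2 addbF /= GRing.signr_addb.
Qed.

End TreeLists.

(** * Spanning trees as rooted trees *)

Section SpanningTrees.
Variable T : finType.
Implicit Types (H : graph3 T) (S : {set {set T}}) (t : {set T}).
Implicit Types (r x y z : T) (l : seq (T * T * T)).

Lemma tset_verts r l t x : grown r l -> t \in map (@tset T) l -> x \in t ->
  x \in verts r l.
Proof.
elim: l => [|[[p c] d] l IH] //= /and5P[pl _ _ _ gl].
rewrite inE => /orP[/eqP->|/IH IH' /(IH' gl)]; last by rewrite !inE => ->; rewrite !orbT.
rewrite !inE -orbA => /or3P[/eqP->|/eqP->|/eqP->]; rewrite ?eqxx ?orbT //.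
by rewrite pl !orbT.
Qed.

Lemma grown_notin r p c d l :
  c \notin verts r l -> grown r l -> tset (p, c, d) \notin map (@tset T) l.
Proof.
move=> cl gl; apply: contra cl => /(tset_verts gl); apply.
by rewrite !inE eqxx orbT.
Qed.

Lemma grown_uniq_tset r l : grown r l -> uniq (map (@tset T) l).
Proof.
elim: l => [|[[p c] d] l IH] //= /and5P[_ cl _ _ gl].
by rewrite (grown_notin _ _ cl gl) IH.
Qed.

Lemma ordS_neq n (i : 'I_n) : 1 < n -> ordS i != i.
Proof. by move=> n1; have := ord_pred_neq (ordS i) n1; rewrite ordSK eq_sym. Qed.

(* A cycle through the last triple (p c d) has one of its vertices among c and
   d, and no other triple contains that vertex. *)
Lemma grown_acyclic r l S : grown r l -> S =i map (@tset T) l -> ~ has_cycle S.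
Proof.
elim: l S => [|[[p c] d] l IH] S /=.
  by move=> _ S0 [n [a [t [n2 _ _ /(_ (Ordinal (ltnW n2)))[]]]]]; rewrite S0.
case/and5P=> pl cl dl cd gl SE [n [a [t [n2 aI tI ct]]]].
set t0 := tset (p, c, d) in SE.
have only i j x : i != j -> t i = t0 -> x \in t j -> x \in [:: c; d] -> False.
  move=> ij ti xj xcd; have [tS _ _] := ct j.
  move: tS; rewrite SE inE => /orP[/eqP tj|tj].
    by case/eqP: ij; apply: tI; rewrite ti tj.
  have xl := tset_verts gl tj xj.
  by move: xcd cl dl; rewrite !inE => /orP[]/eqP<-; rewrite xl.
have [/existsP[i /eqP ti]|no] := boolP [exists i, t i == t0].
  have [_ ai aSi] := ct i.
  have [nS nP] := (ordS_neq i n2, ord_pred_neq i n2).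
  have [|ainew] := boolP (a i \in [:: c; d]).
    apply: (only i (ord_pred i)); rewrite // 1?eq_sym //.
    by have [_ _] := ct (ord_pred i); rewrite ord_predK.
  have [|asnew] := boolP (a (ordS i) \in [:: c; d]).
    apply: (only i (ordS i)); rewrite // 1?eq_sym //.
    by have [_] := ct (ordS i).
  move: ai aSi ainew asnew; rewrite ti !inE -!orbA !negb_or.
  move=> /or3P[/eqP ai|->|->] /or3P[/eqP aS|->|->]; rewrite ?andbF // => _ _.
  by case/eqP: nS; apply: aI; rewrite aS ai.
apply: (IH [set t1 in map (@tset T) l] gl); first by move=> ?; rewrite inE.
exists n, a, t; split=> // i; have [tS ai aS] := ct i; split=> //.
move: tS; rewrite SE !inE => /orP[/eqP ti|//].
by case/existsP: no; exists i; rewrite ti.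
Qed.

Lemma share_sym S x y : share_triple S x y = share_triple S y x.
Proof. by apply: eq_existsb => t; rewrite [(x \in t) && _]andbC. Qed.

Lemma grown_connect r l S x : {subset map (@tset T) l <= S} -> grown r l ->
  x \in verts r l -> connect (share_triple S) r x.
Proof.
elim: l x => [|[[p c] d] l IH] x /= lS; first by rewrite inE => _ /eqP->.
case/and5P=> pl _ _ _ gl.
have {}IH y : y \in verts r l -> connect (share_triple S) r y.
  by apply: IH => // t tl; apply: lS; rewrite inE tl orbT.
rewrite !inE orbA => /orP[xcd|]; last exact: IH.
apply: connect_trans (IH p pl) (connect1 _).
apply/existsP; exists (tset (p, c, d)); rewrite lS ?mem_head //= !inE eqxx /=.
by case/orP: xcd => ->; rewrite ?orbT.
Qed.

Lemma grown_cover r l x : l != [::] -> grown r l -> x \in verts r l ->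
  exists2 t, t \in map (@tset T) l & x \in t.
Proof.
elim: l => [|[[p c] d] l IH] //= _ /and5P[pl _ _ _ gl].
rewrite !inE orbA => /orP[xcd|xl].
  exists (tset (p, c, d)); rewrite ?mem_head // !inE.
  by case/orP: xcd => ->; rewrite ?orbT.
have [l0|l0] := eqVneq l [::].
  exists (tset (p, c, d)); rewrite ?mem_head // !inE.
  by move: pl xl; rewrite l0 !inE => /eqP-> ->.
by have [t tl xt] := IH l0 gl xl; exists t; rewrite // inE tl orbT.
Qed.

(** The list must be nonempty: the empty set of triples does not cover the root. *)
Lemma grown_spanning H S r l : l != [::] -> grown r l ->
  verts r l =i vertices H -> S =i map (@tset T) l -> S \subset triples H ->
  spanning_tree H S.
Proof.
move=> l0 gl vl SE SH; split=> //.
- exact: grown_acyclic gl SE.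
- apply/setP=> x; rewrite -vl; apply/bigcupP/idP => [[t tS]|].
    by apply: tset_verts gl _; rewrite -SE.
  by case/(grown_cover l0 gl) => t tl xt; exists t; rewrite ?SE.
- move=> x y; rewrite -!vl => xl yl.
  have lS : {subset map (@tset T) l <= S} by move=> t; rewrite SE.
  apply: connect_trans (grown_connect lS gl yl).
  rewrite (sym_connect_sym (@share_sym S)).
  exact: grown_connect lS gl xl.
Qed.

(** A state pairs the triple just used with the vertex it led to. The triple of the initial state is
    a dummy, taken to be [set0] below. *)
Definition hstep : rel ({set T} * T) :=
  fun u v => (u.2 \in v.1) && (v.2 \in v.1).

(** A path between old vertices comes from induction. If one end is c or d, the triple (p c d) is
    added to a path ending at p; between c and d it suffices alone. *)
Lemma grown_path r l x z : grown r l -> x \in verts r l -> z \in verts r l ->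
  exists s, [/\ path hstep (set0, x) s, (last (set0, x) s).2 = z,
    uniq (x :: unzip2 s), uniq (unzip1 s) &
    {subset unzip1 s <= map (@tset T) l} /\ {subset unzip2 s <= verts r l}].
Proof.
elim: l x z => [|[[p c] d] l IH] x z /=.
  by rewrite !inE => _ /eqP-> /eqP->; exists [::]; split.
case/and5P=> pl cl dl cd gl; set t0 := tset (p, c, d).
have t0l : t0 \notin map (@tset T) l by apply: grown_notin cl gl.
have pt0 : p \in t0 by rewrite !inE eqxx.
have new y : y \in [:: c, d & verts r l] ->
    y \in verts r l \/ y \in t0 /\ y \notin verts r l.
  by rewrite !inE => /or3P[/eqP->|/eqP->|->]; [right|right|left]; 
    rewrite ?eqxx ?orbT.
have wide s : {subset unzip1 s <= map (@tset T) l} /\ {subset unzip2 s <= verts r l} ->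
    {subset unzip1 s <= t0 :: map (@tset T) l} /\
    {subset unzip2 s <= [:: c, d & verts r l]}.
  by case=> s1 s2; split=> y; [move/s1|move/s2]; rewrite !inE => ->; rewrite ?orbT.
move=> xl zl; have [xo|[xt xn]] := new x xl; have [zo|[zt zn]] := new z zl.
- have [s [ps ls u2 u1 /wide ss]] := IH x z gl xo zo.
  by exists s; split.
- have [s [ps ls u2 u1 ss]] := IH x p gl xo pl.
  exists (rcons s (t0, z)); have [s1 s2] := ss; split.
  + by rewrite rcons_path ps /hstep ls /= pt0 zt.
  + by rewrite last_rcons.
  + have -> : unzip2 (rcons s (t0, z)) = rcons (unzip2 s) z.
      by rewrite /unzip2 map_rcons.
    rewrite -/(uniq (x :: rcons _ z)) -rcons_cons rcons_uniq u2 andbT inE.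
    rewrite negb_or; apply/andP; split.
      by apply: contraNneq zn => ->.
    by apply: contra zn => /s2.
  + by rewrite /unzip1 map_rcons rcons_uniq u1 andbT; apply: contra t0l => /s1.
  + have [w1 w2] := wide s ss; split=> y; rewrite /unzip1 /unzip2 map_rcons mem_rcons inE.
      by case/orP=> [/eqP->|/w1//]; rewrite mem_head.
    by case/orP=> [/eqP->|/w2//].
- have [s [ps ls u2 u1 ss]] := IH p z gl pl zo.
  exists ((t0, p) :: s); have [s1 s2] := ss; split=> //=.
  + by rewrite /hstep /= xt pt0 /=; case: (s) ps.
  + by case: (s) ls.
  + rewrite -/(uniq (p :: unzip2 s)) u2 andbT inE negb_or.
    apply/andP; split; last by apply: contra xn => /s2.
    by apply: contraNneq xn => ->.
  + by rewrite u1 andbT; apply: contra t0l => /s1.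
  + have [w1 w2] := wide s ss; split=> y; rewrite inE.
      by case/orP=> [/eqP->|/w1//]; rewrite mem_head.
    by case/orP=> [/eqP->|/w2//]; rewrite !inE pl !orbT.
- have [<-|xz] := eqVneq x z; first by exists [::]; split.
  exists [:: (t0, z)]; split=> //=; first by rewrite /hstep /= xt zt.
    by rewrite inE xz.
  by split=> y; rewrite inE => /eqP-> //; rewrite mem_head.
Qed.

Lemma path_cycle S x s t : path hstep (set0, x) s -> s != [::] ->
  uniq (x :: unzip2 s) -> uniq (unzip1 s) -> {subset unzip1 s <= S} ->
  t \in S -> t \notin unzip1 s -> x \in t -> (last (set0, x) s).2 \in t ->
  has_cycle S.
Proof.
move=> ps s0 u2 u1 sS tS ts xt zt.
pose n := size s.
(* The cycle follows the path from x and returns through t, which is therefore its last triple. *)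
pose a (i : 'I_n.+1) := nth x (x :: unzip2 s) i.
pose tr (i : 'I_n.+1) := nth t (rcons (unzip1 s) t) i.
have aE i : i <= n -> nth x (x :: unzip2 s) i = (nth (set0, x) ((set0, x) :: s) i).2.
  by case: i => // i ilt; rewrite /= (nth_map (set0, x)).
exists n.+1, a, tr; split.
- by rewrite ltnS lt0n size_eq0.
- move=> i j /eqP; rewrite nth_uniq ?size_map //= ?size_map // => /eqP.
  exact: val_inj.
- move=> i j /eqP; rewrite nth_uniq ?rcons_uniq ?ts ?u1 ?size_rcons ?size_map //.
  by move/eqP/val_inj.
move=> i; rewrite /a /tr.
have [ilt|ige] := ltnP i n; last first.
  have -> : i = n :> nat by apply/eqP; rewrite eqn_leq ige -ltnS ltn_ord.
  have ->: ordS i = 0 :> nat.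
    have e : i = n :> nat by apply/eqP; rewrite eqn_leq ige -ltnS ltn_ord.
    by rewrite /= e modnn.
  rewrite nth_rcons size_map ltnn eqxx aE //; split=> //.
  by move: zt; rewrite (last_nth (set0, x)).
have ->: ordS i = i.+1 :> nat by rewrite /= modn_small.
rewrite !aE // ?(ltnW ilt) // nth_rcons size_map ilt (nth_map (set0, x)) //.
have /(pathP (set0, x))/(_ _ ilt)/andP[-> ->] := ps; split=> //.
by apply: sS; apply: map_f; rewrite mem_nth.
Qed.

(** In an acyclic S this forces a newly attached triple to have only one old vertex, and leaves no
    triple over once all vertices are reached. *)
Lemma grown_cycle r l S t x z : grown r l -> x \in verts r l ->
  z \in verts r l -> x != z -> {subset map (@tset T) l <= S} ->
  t \in S -> t \notin map (@tset T) l -> x \in t -> z \in t -> has_cycle S.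
Proof.
move=> gl xl zl xz lS tS tl xt zt.
have [s [ps ls u2 u1 [s1 _]]] := grown_path gl xl zl.
apply: (path_cycle ps _ u2 u1 _ tS) => //; last by rewrite ls.
- by apply: contraNneq xz => s0; rewrite -ls s0.
- by move=> y /s1/lS.
- by apply: contra tl => /s1.
Qed.

Lemma connect_cross (e : rel T) (P : pred T) x y : connect e x y ->
  P x -> ~~ P y -> exists u v, [/\ P u, ~~ P v & e u v].
Proof.
case/connectP=> s; elim: s x => [|v s IH] x /=; first by move=> _ -> ->.
case/andP=> xv vs yE Px Py; have [Pv|Pv] := boolP (P v); first exact: IH vs _ Pv Py.
by exists x, v.
Qed.

Lemma triple_third t x y : #|t| = 3 -> x \in t -> y \in t -> x != y ->
  exists2 z, t = [set x; y; z] & z != x /\ z != y.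
Proof.
move=> t3 xt yt xy.
have : #|t :\ x :\ y| == 1.
  by move: t3; rewrite (cardsD1 x) xt (cardsD1 y) !inE eq_sym xy yt => /eqP.
case/cards1P=> z tE; have : z \in t :\ x :\ y by rewrite tE inE.
rewrite !inE => /and3P[zy zx zt]; exists z => //.
apply/eqP; rewrite eq_sym eqEcard t3 -setUA.
rewrite !cardsU1 cards1 !inE negb_or xy (eq_sym x) (eq_sym y) zx zy /= andbT.
by apply/subsetP=> u; rewrite !inE => /or3P[]/eqP->.
Qed.

(** Greedy growth: while a vertex is missing, connectivity gives a triple of S leaving the current
    vertex set, and acyclicity makes its other two vertices new. At the end, any further triple of S
    would close a cycle. *)
Lemma spanning_grown H S r : spanning_tree H S -> r \in vertices H ->
  exists l, [/\ grown r l, verts r l =i vertices H &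
                perm_eq (enum S) (map (@tset T) l)].
Proof.
case=> SH acS cS conS rH.
have step n : exists l, [/\ grown r l, {subset map (@tset T) l <= S} &
    size l = n \/ verts r l =i vertices H].
  elim: n => [|n [l [gl lS ln]]]; first by exists [::]; split=> //; left.
  case: ln => [ln|]; last by exists l; split=> //; right.
  have lH : {subset verts r l <= vertices H}.
    move=> x; have [->|l0] := eqVneq l [::]; first by rewrite inE => /eqP->.
    by case/(grown_cover l0 gl)=> t /lS tS xt; rewrite -cS; apply/bigcupP; exists t.
  have [Hl|/subsetPn[v vH vl]] := boolP (vertices H \subset verts r l).
    exists l; split=> //; right=> x; apply/idP/idP; first exact: lH.
    exact: (subsetP Hl).
  have [x [y [xl yl /existsP[t /andP[tS /andP[xt yt]]]]]] :=
    connect_cross (conS _ _ rH vH) (verts_root r l) vl.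
  have /triplesP/andP[_ /eqP t3] := subsetP SH _ tS.
  have xy : x != y by apply: contraNneq yl => <-.
  have [z tE [zx zy]] := triple_third t3 xt yt xy.
  have tl : t \notin map (@tset T) l by apply: contra yl => tl; apply: tset_verts gl tl yt.
  exists ((x, y, z) :: l); split=> /=; last by left; rewrite ln.
    rewrite [x \in _]xl [y \in _](negPf yl) gl eq_sym zy !andbT /=.
    apply/negP=> zl; apply: acS.
    apply: (grown_cycle gl xl zl _ lS tS tl xt); first by rewrite eq_sym.
    by rewrite tE !inE eqxx orbT.
  by move=> u; rewrite inE => /orP[/eqP->|/lS//]; rewrite /tset /= -tE.
(* A list of #|T| triples would have 2 #|T| + 1 distinct vertices, too many for T, so the growth has
   stopped by then. *)
have [l [gl lS ln]] := step #|T|.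
have vl : verts r l =i vertices H.
  case: ln => // ln; have := max_card (mem (verts r l)).
  rewrite (card_uniqP _) ?grown_uniq // size_verts ln -addnn ltnNge.
  by rewrite leq_addr.
exists l; split=> //; apply: uniq_perm (enum_uniq _) (grown_uniq_tset gl) _ => t.
rewrite mem_enum; apply/idP/idP=> [tS|/lS//].
apply: contraT => tl; case: acS.
have /triplesP/andP[/subsetP tH /eqP t3] := subsetP SH _ tS.
have /card_gt1P[x [y [xt yt xy]]] : 1 < #|t| by rewrite t3.
by apply: (grown_cycle gl _ _ xy lS tS tl xt yt); rewrite vl tH.
Qed.

(** Exchanging the two children of a triple reverses its 3-cycle and keeps the list grown, so each
    triple can be made to agree with w. *)
Lemma spanning_tree_list H S r w : spanning_tree H S -> r \in vertices H ->
  orientation H w -> exists l, tree_list H w S r l.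
Proof.
move=> sS rH ow; have [l [gl vl pl]] := spanning_grown sS rH.
have lH : {subset map (@tset T) l <= triples H}.
  by move=> t; rewrite -(perm_mem pl) mem_enum; case: sS => /subsetP + _ _ _; apply.
have [l' [gl' vl' tl' wl']] : exists l', [/\ grown r l', verts r l' =i verts r l,
    map (@tset T) l' = map (@tset T) l & {in l', forall u, w (tset u) = cyc u}].
  elim: l gl lH {vl pl} => [|[[p c] d] l IH] /=; first by exists [::]; split.
  case/and5P=> pl cl dl cd gl lH.
  have [|l' [gl' vl' tl' wl']] := IH gl.
    by move=> t tl; apply: lH; rewrite inE tl orbT.
  have tH := lH _ (mem_head _ _).
  have [pc pd] : p != c /\ p != d.
    by split; [apply: contraNneq cl|apply: contraNneq dl] => <-.
  have [i [j [m [tE wE]]]] := ow _ tH.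
  have ijm : [&& i != j, i != m & j != m].
    have /andP[_] := triplesP tH; rewrite tE -setUA !cardsU1 cards1 !inE negb_or.
    by case: (i == j); case: (i == m); case: (j == m).
  case/and3P: ijm => ij im jm.
  have [cE|cE] := cycle3_orient pc pd cd ij im jm (esym tE).
    exists ((p, c, d) :: l'); split=> /=.
    - by rewrite !vl' pl cl dl cd gl'.
    - by move=> x; rewrite !inE vl'.
    - by rewrite tl'.
    - by move=> x; rewrite inE => /orP[/eqP->|/wl'//]; rewrite wE.
  have cdE : tset (p, d, c) = tset (p, c, d) by rewrite /tset /= setUAC.
  exists ((p, d, c) :: l'); split=> /=.
  - by rewrite !vl' pl cl dl eq_sym cd gl'.
  - by move=> x; rewrite !inE vl' orbCA.
  - by rewrite tl' cdE.
  - by move=> x; rewrite inE => /orP[/eqP->|/wl'//]; rewrite cdE wE.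
exists l'; split=> //; last by rewrite tl'.
by move=> x; rewrite vl'.
Qed.

End SpanningTrees.

(** * Deletion and contraction *)

Section Minors.
Local Open Scope group_scope.
Variable T : finType.
Implicit Types (H : graph3 T) (S : {set {set T}}) (t e : {set T}).
Implicit Types (r x y z : T) (l : seq (T * T * T)) (w : {set T} -> {perm T}).

Lemma tree_sgn_neq0 H w S r l : tree_list H w S r l -> (tree_sgn H w S != 0)%R.
Proof.
move=> tl; have [s sP] := tree_list_arranges tl.
by rewrite (tree_sgn_arranges (tree_list_odd tl) sP) GRing.signr_eq0.
Qed.

(** A spanning tree of the deletion is one of H avoiding e, with the same sign since the vertices
    and w are unchanged. *)
Lemma pfaffian_delete H w e : orientation H w ->
  (forall S1 S2, spanning_tree H S1 -> spanning_tree H S2 ->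
     e \notin S1 -> e \notin S2 -> tree_sgn H w S1 = tree_sgn H w S2) ->
  pfaffian3 (delete H e).
Proof.
move=> ow same; exists w; split; first by move=> t /setD1P[_ /ow].
have del S : spanning_tree (delete H e) S -> spanning_tree H S /\ e \notin S.
  case=> /subsetD1P[SH eS] acS cS conS; split=> //.
by move=> S1 S2 /del[t1 e1] /del[t2 e2]; apply: same.
Qed.

Lemma map_renames (s : {perm T}) r l1 l2 :
  map s (verts r l1) = verts r l2 -> s r = r /\ renames s l1 l2.
Proof.
elim: l1 l2 => [|[[p1 c1] d1] l1 IH] [|[[p2 c2] d2] l2] //=.
  by case=> ->; split.
by case=> -> -> /IH[-> ->]; rewrite !eqxx.
Qed.

(** The vertex lists are matched position by position; the root, last in both, is fixed. *)
Lemma grown_renames r l1 l2 : grown r l1 -> grown r l2 ->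
  verts r l1 =i verts r l2 ->
  exists s, [/\ perm_on [set x in verts r l1] s, s r = r & renames s l1 l2].
Proof.
move=> /grown_uniq; set q1 := verts r l1 => u1.
move=> /grown_uniq; set q2 := verts r l2 => u2 q12.
have sz : size q1 = size q2 by apply/perm_size/uniq_perm.
pose f x := if x \in q1 then nth x q2 (index x q1) else x.
have f_out x : x \notin q1 -> f x = x by rewrite /f => /negPf->.
have f_in x : x \in q1 -> f x \in q1.
  by move=> xq; rewrite /f xq q12 mem_nth // -sz index_mem.
have f_inj : injective f.
  move=> x y; have [xq|xq] := boolP (x \in q1); have [yq|yq] := boolP (y \in q1).
  - rewrite /f xq yq (set_nth_default y) -?sz ?index_mem //.
    move/eqP; rewrite nth_uniq -?sz ?index_mem // => /eqP.
    by move/(congr1 (nth x q1)); rewrite !nth_index.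
  - by rewrite (f_out y) // => xy; move: (f_in _ xq); rewrite xy (negPf yq).
  - by rewrite (f_out x) // => xy; move: (f_in _ yq); rewrite -xy (negPf xq).
  - by rewrite !f_out.
have [|s_r s_l] := @map_renames (perm f_inj) r l1 l2.
  apply: (@eq_from_nth _ r) => [|i]; rewrite size_map // => iq.
  rewrite (nth_map r) // permE /f mem_nth // index_uniq // -/q2.
  by apply: set_nth_default; rewrite -sz.
exists (perm f_inj); split=> //; apply/subsetP=> x; rewrite !inE permE.
by apply: contraR => /f_out->.
Qed.

Lemma grown_mem r l u : grown r l -> u \in l ->
  [/\ u.1.1 \in verts r l, u.1.2 \in verts r l, u.2 \in verts r l,
      u.1.2 != r & u.2 != r].
Proof.
elim: l => [|[[p c] d] l IH] //= /and5P[pl cl dl _ gl]; rewrite inE.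
case/orP=> [/eqP->|/(IH gl)[p' c' d' cr dr]] /=; last first.
  by rewrite !inE p' c' d' !orbT.
rewrite !inE pl !eqxx !orbT; split=> //.
  by apply: contraNneq cl => ->; apply: verts_root.
by apply: contraNneq dl => ->; apply: verts_root.
Qed.

Section Contraction.
Variables (H : graph3 T) (w : {set T} -> {perm T}) (e : {set T}) (a : T).
Hypotheses (eH : e \in triples H) (ae : a \in e) (ow : orientation H w).

Let H' := contract eH ae.

Definition lifts t' t :=
  (t \in triples H) &&
  ((t' == t) && [disjoint t & e] || (t' == a |: t :\: e) && (#|t :&: e| == 1)%N).

(** Several triples of H may contract to the same triple; one of them is chosen. *)
Definition lift_triple t' := odflt t' [pick t | lifts t' t].

(** The vertex of e in the lifted triple. If that triple is disjoint from e, the default a makes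
    [tperm a (attach t')] the identity. *)
Definition attach t' := odflt a [pick x in lift_triple t' :&: e].

Definition contract_orient t' := w (lift_triple t') ^ tperm a (attach t').

Lemma lift_tripleP t' : t' \in triples H' -> 
  [/\ lift_triple t' \in triples H, attach t' \in e &
      lift_triple t' = tperm a (attach t') @: t'].
Proof.
move=> t'H; have : lifts t' (lift_triple t').
  rewrite /lift_triple; case: pickP => //= no; exfalso.
  move: t'H; rewrite /= /contract_triples => /setUP[|/imsetP[t]]; rewrite inE => /andP[tH tP].
    by move: (no t'); rewrite /lifts tH eqxx tP.
  by move=> tE; move: (no t); rewrite /lifts tH tE eqxx tP orbT.
rewrite /attach; set t := lift_triple t'; case/andP=> tH /orP[|]/andP[/eqP t'E te].
  rewrite tH; case: pickP => /= [x|_].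
    by rewrite !inE => /andP[xt xe]; rewrite (disjointFr te xt) in xe.
  rewrite ae tperm1 t'E; split=> //; apply/setP=> x; apply/idP/imsetP=> [xt|].
    by exists x; rewrite ?perm1.
  by case=> y yt ->; rewrite perm1.
have [x teE] := cards1P te.
case: pickP => [y0|/(_ x)]; rewrite /= teE !inE ?eqxx // => /eqP->.
have : x \in t :&: e by rewrite teE inE.
rewrite inE => /andP[xt xe]; split=> //.
have nte y : y \in t -> (y \in e) = (y == x).
  by move=> yt; rewrite -in_set1 -teE inE yt.
rewrite t'E; apply/setP=> y; apply/idP/imsetP=> [yt|].
  have [->|yx] := eqVneq y x; first by exists a; rewrite ?tpermL // setU11.
  have ye : y \notin e by rewrite nte.
  exists y; first by rewrite !inE ye yt orbT.
  rewrite tpermD // 1?eq_sym //; by apply: contraNneq ye => ->.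
case=> z /setU1P[->|/setDP[zt ze]] ->; first by rewrite tpermL.
rewrite tpermD //; first by apply: contraNneq ze => <-.
by apply: contraNneq ze => <-.
Qed.

Lemma contract_orientation : orientation H' contract_orient.
Proof.
move=> t' /lift_tripleP[tH _ tE]; have [i [j [k [lE wE]]]] := ow tH.
set s := tperm a (attach t') in tE *.
exists (s i), (s j), (s k); split; last by rewrite /contract_orient wE cycle3J.
have -> : t' = s @: lift_triple t'.
  rewrite tE -imset_comp -[LHS]imset_id; apply: eq_imset => x.
  by rewrite /= tpermK.
by rewrite lE !imsetU !imset_set1.
Qed.

Lemma orient_at : exists b c, [/\ e = tset (a, b, c), w e = cyc (a, b, c),
  a != b, a != c & b != c].
Proof.
have /andP[_ /eqP e3] := triplesP eH; have [i [j [k [eE wE]]]] := ow eH.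
have : [&& i != j, i != k & j != k].
  move/eqP: e3; rewrite eE -setUA !cardsU1 cards1 !inE negb_or.
  by case: (i == j); case: (i == k); case: (j == k).
case/and3P=> ij ik jk; have : a \in [set i; j; k] by rewrite -eE.
rewrite !inE -orbA => /or3P[]/eqP->.
- by exists j, k; split.
- exists k, i; split=> //; rewrite 1?eq_sym //; last by rewrite wE cycle3_rot.
  by rewrite eE; apply/setP=> x; rewrite !inE; do 3!case: (x == _).
- exists i, j; split=> //; rewrite 1?eq_sym //; last first.
    by rewrite wE /cyc /= [RHS]cycle3_rot // eq_sym.
  by rewrite eE; apply/setP=> x; rewrite !inE; do 3!case: (x == _).
Qed.

(* A tree of H / e rooted at a lifts to a tree of H which starts with e. *)
Definition lift_list b c l : seq (T * T * T) :=
  rcons [seq (tperm a (attach (tset u)) u.1.1, u.1.2, u.2) | u <- l] (a, b, c).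

Lemma lift_renames b c (s : {perm T}) l1 l2 : s b = b -> s c = c ->
  renames s l1 l2 -> renames s (lift_list b c l1) (lift_list b c l2).
Proof.
move=> sb sc; rewrite /lift_list.
elim: l1 l2 => [|[[p1 c1] d1] l1 IH] [|[[p2 c2] d2] l2] //=.
  by rewrite sb sc !eqxx.
by case/and3P=> -> -> /IH->.
Qed.

Lemma lift_verts b c l x :
  (x \in verts a (lift_list b c l)) = (x \in [:: b; c]) || (x \in verts a l).
Proof.
rewrite /lift_list; elim: l => [|[[p y] z] l IH] /=; first by rewrite !inE orbA.
by rewrite !in_cons IH !inE; do !case: (x == _) => //=; rewrite ?orbT.
Qed.

(** A parent a becomes a vertex of e, which is present from the start; the other parents lie outside
    e and are not moved. *)
Lemma grown_lift b c l : e = tset (a, b, c) -> a != b -> a != c -> b != c ->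
  {in l, forall u, [/\ attach (tset u) \in e, (u.1.1 == a) || (u.1.1 \notin e),
                       u.1.2 \notin e & u.2 \notin e]} ->
  grown a l -> grown a (lift_list b c l).
Proof.
move=> eE ab ac bc; elim: l => [|[[p y] z] l IH] lP /=.
  by rewrite !inE eqxx eq_sym ab eq_sym ac bc.
case/and5P=> pl yl zl yz gl; have /= [xe pe ye ze] := lP _ (mem_head _ _).
have out v : v \notin e -> v \notin verts a l -> v \notin verts a (lift_list b c l).
  move=> ve vl; rewrite lift_verts !inE (negPf vl) orbF.
  by apply: contra ve; rewrite eE !inE -orbA => ->; rewrite orbT.
rewrite -/(lift_list b c l) !out // yz IH ?andbT //; last first.
  by move=> u ul; apply: lP; rewrite inE ul orbT.
set x := attach _ in xe *; have [->|pa] := eqVneq p a.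
  rewrite tpermL lift_verts; move: xe; rewrite eE !inE -orbA.
  by case/or3P=> [/eqP->|->|->]; rewrite ?orbT // verts_root orbT.
rewrite (negPf pa) /= in pe.
rewrite tpermD 1?eq_sym // 1?eq_sym ?lift_verts ?pl ?orbT //.
by apply: contraNneq pe => <-.
Qed.

(** Since a is the root and the only vertex of e in H / e, it is never a child. Lifting therefore
    changes parents only, and the orientations still match. *)
Lemma lift_tree_list S l b c : S \subset triples H' ->
  e = tset (a, b, c) -> w e = cyc (a, b, c) -> a != b -> a != c -> b != c ->
  tree_list H' contract_orient S a l ->
  tree_list H w (e |: lift_triple @: S) a (lift_list b c l).
Proof.
move=> SH eE wE ab ac bc [gl vl pl wl].
have lS u : u \in l -> tset u \in S.
  by move=> ul; rewrite -mem_enum (perm_mem pl) map_f.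
have lP : {in l, forall u, [/\ attach (tset u) \in e,
    (u.1.1 == a) || (u.1.1 \notin e), u.1.2 \notin e & u.2 \notin e]}.
  have out x : x \in verts a l -> x != a -> x \notin e.
    by rewrite vl !inE => /andP[+ _] xa; rewrite xa.
  move=> u ul; have [pV cV dV cr dr] := grown_mem gl ul.
  have [_ xe _] := lift_tripleP (subsetP SH _ (lS u ul)).
  by split=> //; try exact: out; case: eqVneq => //= pa; rewrite out.
have lE : {in l, forall u, lift_triple (tset u) =
    tset (tperm a (attach (tset u)) u.1.1, u.1.2, u.2)
    /\ w (lift_triple (tset u)) =
    cyc (tperm a (attach (tset u)) u.1.1, u.1.2, u.2)}.
  move=> u ul; have [xe _ ce de] := lP u ul.
  have [_ _ tE] := lift_tripleP (subsetP SH _ (lS u ul)).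
  set x := attach (tset u) in xe tE *.
  have out y : y \notin e -> tperm a x y = y.
    by move=> ye; rewrite tpermD //; apply: contraNneq ye => <-.
  split; first by rewrite tE /tset !imsetU !imset_set1 /= (out _ ce) (out _ de).
  have := wl u ul; rewrite /contract_orient -/x => /(congr1 (fun v => v ^ tperm a x)).
  by rewrite -{2}(tpermV a x) conjgK => ->; rewrite /cyc cycle3J /= (out _ ce) (out _ de).
have gL := grown_lift eE ab ac bc lP gl.
have [bV cV] : b \in vertices H /\ c \in vertices H.
  have /andP[/subsetP eV _] := triplesP eH.
  by split; apply: eV; rewrite eE !inE eqxx ?orbT.
have tL : map (@tset T) (lift_list b c l) =
    rcons (map lift_triple (map (@tset T) l)) e.
  rewrite /lift_list map_rcons -eE -!map_comp; congr rcons.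
  by apply/eq_in_map => u /lE[/= -> _].
split=> //.
- move=> x; rewrite lift_verts vl !inE eE !inE.
  have [->|xb] := eqVneq x b; first by rewrite bV.
  have [->|xc] := eqVneq x c; first by rewrite cV.
  by case: (x == a).
- apply: uniq_perm (enum_uniq _) (grown_uniq_tset gL) _ => t.
  rewrite mem_enum tL mem_rcons !inE; congr (_ || _).
  apply/imsetP/mapP=> -[t' t'S ->]; exists t' => //.
    by rewrite -(perm_mem pl) mem_enum.
  by rewrite -mem_enum (perm_mem pl).
- move=> u; rewrite mem_rcons inE => /orP[/eqP->|/mapP[v vl' ->]].
    by rewrite -eE.
  by have [<- <-] := lE v vl'.
Qed.

(** Two trees of H / e and their lifts are related by the same renaming, which fixes b and c, so the
    ratio of the signs is the same in H / e and in H. *)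
Lemma pfaffian_contract :
  (forall S1 S2, spanning_tree H S1 -> spanning_tree H S2 ->
     e \in S1 -> e \in S2 -> tree_sgn H w S1 = tree_sgn H w S2) ->
  pfaffian3 H'.
Proof.
move=> same; exists contract_orient; split; first exact: contract_orientation.
have [b [c [eE wE ab ac bc]]] := orient_at.
have aV : a \in vertices H'.
  have /andP[/subsetP eV _] := triplesP eH.
  by rewrite !inE eqxx eV.
have lift S : spanning_tree H' S -> exists l,
    [/\ tree_list H' contract_orient S a l,
      tree_list H w (e |: lift_triple @: S) a (lift_list b c l) &
      spanning_tree H (e |: lift_triple @: S)].
  move=> sS; have SH : S \subset triples H' by case: sS.
  have [l tl] := spanning_tree_list sS aV contract_orientation.
  have tL := lift_tree_list SH eE wE ab ac bc tl.
  exists l; split=> //; have [gL vL pL _] := tL.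
  apply: grown_spanning gL vL _ _.
  - by rewrite /lift_list; case: (l) => [|[[]]].
  - by move=> t; rewrite -(perm_mem pL) mem_enum.
  - apply/subsetP=> t /setU1P[->//|/imsetP[t' t'S ->]].
    by have [] := lift_tripleP (subsetP SH _ t'S).
move=> S1 S2 /lift[l1 [t1 tL1 s1]] /lift[l2 [t2 tL2 s2]].
have [[g1 v1 _ _] [g2 v2 _ _]] := (t1, t2).
have [|s [son sa sl]] := grown_renames g1 g2; first by move=> x; rewrite v1 v2.
have out x : x \in e -> x != a -> s x = x.
  by move=> xe xa; rewrite (out_perm son) // inE v1 !inE xe xa.
have onH' : perm_on (vertices H') s.
  by apply: subset_trans son _; apply/subsetP=> x; rewrite inE v1.
have onH : perm_on (vertices H) s by apply: subset_trans onH' (subsetDl _ _).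
have sb : s b = b by rewrite out // 1?eq_sym // eE !inE eqxx orbT.
have sc : s c = c by rewrite out // 1?eq_sym // eE !inE eqxx orbT.
have E' := tree_sgn_renames t1 t2 onH' sa sl.
have E := tree_sgn_renames tL1 tL2 onH sa (lift_renames sb sc sl).
(* Cancelling the nonzero sign of the first lifted tree shows that the renaming is even. *)
have := same _ _ s1 s2 (setU11 _ _) (setU11 _ _); rewrite E E' => /eqP.
rewrite -{1}[tree_sgn _ _ _]GRing.mulr1 => /eqP/(GRing.mulfI (tree_sgn_neq0 tL1)) <-.
by rewrite GRing.mulr1.
Qed.

End Contraction.
End Minors.

(** * The Lucas graph *)

Section IndexedLists.
Local Open Scope group_scope.
Variables (I T : finType) (tri : I -> T * T * T) (r : T).

Lemma verts_map s x : (x \in verts r (map tri s)) =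
  (x == r) || has (fun i => x \in [:: (tri i).1.2; (tri i).2]) s.
Proof.
elim: s => [|i s IH] /=; first by rewrite inE orbF.
case: (tri i) => -[p c] d /=; rewrite !in_cons IH in_nil orbF.
by case: (x == c); case: (x == d); case: (x == r).
Qed.

(** The rank h does not increase along the list, whose head is attached last. A parent that is a
    child of a triple of smaller rank is thus already present. *)
Lemma grown_map (h : I -> nat) s : uniq s -> pairwise (fun i j => h j <= h i) s ->
  {in s, forall i, [/\ (tri i).1.2 != r, (tri i).2 != r & (tri i).1.2 != (tri i).2]} ->
  {in s &, forall i j x, x \in [:: (tri i).1.2; (tri i).2] ->
     x \in [:: (tri j).1.2; (tri j).2] -> i = j} ->
  {in s, forall i, (tri i).1.1 = r \/ exists j, [/\ j \in s, h j < h i &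
     (tri i).1.1 \in [:: (tri j).1.2; (tri j).2]]} ->
  grown r (map tri s).
Proof.
elim: s => [|i s IH] //= /andP[nis us] /andP[/allP hs ps] cd dis par.
have {}IH : grown r (map tri s).
  apply: IH => //.
  - by move=> j js; apply: cd; rewrite inE js orbT.
  - by move=> j j' js js'; apply: dis; rewrite inE ?js ?js' orbT.
  move=> j js; have := par j; rewrite inE js orbT => /(_ isT)[->|]; first by left.
  case=> j' [j's hj pj]; move: j's; rewrite inE => /orP[/eqP jE|j's]; last by right; exists j'.
  by have := hs j js; rewrite leqNgt -jE hj.
have out x : x \in [:: (tri i).1.2; (tri i).2] -> x != r ->
    x \notin verts r (map tri s).
  move=> xi xr; rewrite verts_map (negPf xr) /=; apply/hasPn=> j js.
  apply/negP=> xj; move: nis; rewrite (dis i j _ _ x xi xj) ?js // ?mem_head //.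
  by rewrite inE js orbT.
have [cr dr cd'] := cd i (mem_head _ _).
have pin : (tri i).1.1 \in verts r (map tri s).
  rewrite verts_map; have [->|[j [js hj pj]]] := par i (mem_head _ _).
    by rewrite eqxx.
  move: js; rewrite inE => /orP[/eqP jE|js]; first by rewrite jE ltnn in hj.
  by apply/orP; right; apply/hasP; exists j.
move: cr dr cd' pin out; case: (tri i) => -[p c] d /= cr dr cd' -> out.
by rewrite !out ?cd' // !inE eqxx ?orbT.
Qed.

Lemma renames_map (tri' : I -> T * T * T) (t : {perm T}) s :
  {in s, forall i, t (tri i).1.2 = (tri' i).1.2 /\ t (tri i).2 = (tri' i).2} ->
  renames t (map tri s) (map tri' s).
Proof.
elim: s => [|i s IH] //= ts.
have IH' : renames t (map tri s) (map tri' s).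
  by apply: IH => j js; apply: ts; rewrite inE js orbT.
have := ts i (mem_head _ _); case: (tri i) => -[p c] d; case: (tri' i) => -[p' c'] d'.
by case=> /= -> ->; rewrite !eqxx.
Qed.

End IndexedLists.

(** * Evaluating products of disjoint transpositions *)

Section ProdTperm.
Local Open Scope group_scope.
Variables (I T : finType) (a b : I -> T) (P : pred I).

Lemma prod_tperm_fix (s : seq I) y :
  {in s, forall j, P j -> (y != a j) && (y != b j)} ->
  (\prod_(j <- s | P j) tperm (a j) (b j)) y = y.
Proof.
elim: s => [|j s IH] ys; first by rewrite big_nil perm1.
have ys' : {in s, forall j, P j -> (y != a j) && (y != b j)}.
  by move=> i i_s; apply: ys; rewrite inE i_s orbT.
rewrite big_cons; case: ifP => [Pj|_]; last exact: IH.
have /andP[ya yb] := ys j (mem_head _ _) Pj.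
by rewrite permM tpermD 1?eq_sym // IH.
Qed.

(** The factors before i fix y, and those after i fix its image. *)
Lemma prod_tperm_at i y : P i ->
  (forall j, P j -> j != i -> (y != a j) && (y != b j)) ->
  (forall j, P j -> j != i ->
     (tperm (a i) (b i) y != a j) && (tperm (a i) (b i) y != b j)) ->
  (\prod_(j | P j) tperm (a j) (b j)) y = tperm (a i) (b i) y.
Proof.
move=> Pi y1 y2; have us := index_enum_uniq I.
have /splitPr defs : i \in index_enum I by apply: mem_index_enum.
case: defs us => s1 s2; rewrite cat_uniq /= => /and4P[_ s1i is2 _].
rewrite big_cat big_cons Pi !permM /= [X in tperm _ _ X]prod_tperm_fix.
  apply: prod_tperm_fix => j js Pj; apply: y2 => //.
  by apply: contraNneq is2 => <-.
move=> j js Pj; apply: y1 => //; apply: contraNneq s1i => <-.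
by rewrite js.
Qed.

End ProdTperm.

(** * Rooted trees of the Lucas graph and their relative signs *)

Section Lucas.
Local Open Scope group_scope.
Variables (k : nat) (k2 : 1 < k).
Implicit Types (i j : 'I_k) (Y : {set 'I_k}).

Notation pr := (@ord_pred k).
Notation sc := (@ordS k).
Notation un := (@unprimed k).
Notation pm := (@primed k).
Notation hb := (@hub k).

Definition spoke i : vtx k * vtx k * vtx k := (hb, un i, pm i).
Definition rim i : vtx k * vtx k * vtx k := (un (pr (pr i)), un (pr i), pm i).

Lemma un_inj : injective un. Proof. by move=> i j []. Qed.
Lemma pm_inj : injective pm. Proof. by move=> i j []. Qed.

Lemma iter_pred i j : exists n, iter n pr i = j.
Proof.
have sc_pr n : iter n pr (iter n sc j) = j.
  by elim: n => // n IH; rewrite iterSr /= ordSK.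
(* The number of steps is i - j modulo k, written without a negative term. *)
have iE : iter (i + (k - j)) sc j = i.
  apply: ord_inj; rewrite iter_ordS addnCA subnKC ?(ltnW (ltn_ord j)) //.
  by rewrite modnDr modn_small.
by exists (i + (k - j)); rewrite -[X in iter _ _ X]iE sc_pr.
Qed.

Definition pred_perm : {perm 'I_k} := perm (@ord_pred_inj k).

(** The rotation is a single k-cycle. *)
Lemma odd_pred_perm : odd_perm pred_perm = ~~ odd k.
Proof.
have orb i : porbit pred_perm i = [set: 'I_k].
  apply/setP=> j; rewrite inE; have [n <-] := iter_pred i j.
  have <- : (pred_perm ^+ n) i = iter n pr i.
    by rewrite permX; apply: eq_iter => x; rewrite permE.
  exact: mem_porbit.
rewrite /odd_perm card_ord.
have -> : porbits pred_perm = [set [set: 'I_k]].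
  apply/setP=> X; rewrite inE; apply/imsetP/eqP=> [[i _ ->]|->] //.
  by exists (Ordinal (ltnW k2)).
by rewrite cards1 addbT.
Qed.

(* Y is the set of the i whose spoke {0, i, i'} is used. *)
Definition lucas_tree Y : {set {set vtx k}} :=
  [set tset (if i \in Y then spoke i else rim i) | i : 'I_k].

Definition sparse Y := [forall i, ~~ ((i \in Y) && (sc i \in Y))].

Lemma sparseP Y i : sparse Y -> i \in Y -> sc i \notin Y.
Proof. by move/forallP/(_ i); rewrite negb_and => /orP[/negPf->|]. Qed.

Lemma sparseP' Y i : sparse Y -> i \in Y -> pr i \notin Y.
Proof. by move=> sY iY; apply/negP=> /(sparseP sY); rewrite ord_predK iY. Qed.

(* The unprimed vertex below the triple with index i when the tree is rooted at
   the hub. *)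
Definition child Y i := if i \in Y then i else if pr i \in Y then pr (pr i) else pr i.

(** For y in Y, the spoke y has child y, and the rim triple y + 1, hanging at y, has child y - 1.
    Exchanging y and y + 1 before the rotation produces this; for sparse Y these transpositions are
    disjoint. *)
Definition child_perm Y : {perm 'I_k} := (\prod_(y in Y) tperm y (sc y)) * pred_perm.

Lemma child_permE Y i : sparse Y -> child_perm Y i = child Y i.
Proof.
move=> sY; rewrite permM permE /child.
case: ifP => [iY|/negbT iY].
  rewrite (@prod_tperm_at _ _ id sc (mem Y) i) // ?tpermL ?ordSK // => j jY ji.
    by rewrite eq_sym ji; apply: contraTneq iY => ->; apply: sparseP.
  rewrite (inj_eq (@ordS_inj k)) [i == j]eq_sym ji andbT.
  by apply: contraTneq jY => <-; apply: sparseP.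
case: ifP => [piY|/negbT piY].
  rewrite (@prod_tperm_at _ _ id sc (mem Y) (pr i)) // ?ord_predK ?tpermR // => j jY ji.
    rewrite (contraNneq _ iY) /=; last by move=> ->; apply: jY.
    by apply: contraNneq ji => ->; rewrite ordSK.
  rewrite eq_sym ji /=.
  by apply: contraTneq piY => ->; apply: sparseP sY jY.
rewrite (@prod_tperm_fix _ _ id sc (mem Y)) // => j _ jY.
rewrite (contraNneq _ iY) /=; last by move=> ->; apply: jY.
by apply: contraNneq piY => ->; rewrite ordSK.
Qed.

Lemma child_inj Y : sparse Y -> injective (child Y).
Proof. by move=> sY i j; rewrite -!child_permE //; apply: perm_inj. Qed.

Lemma odd_child_perm Y : odd_perm (child_perm Y) = odd #|Y| (+) ~~ odd k.
Proof.
rewrite odd_permM odd_pred_perm; congr (_ (+) _).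
rewrite (big_morph (@odd_perm _) (@odd_permM _) (@odd_perm1 _)).
rewrite -sum1_card (big_morph odd oddD (erefl _)).
by apply: eq_bigr => i _; rewrite odd_tperm eq_sym ordS_neq.
Qed.

Notation H := (lucas_graph k2).

Definition element Y i := if i \in Y then spoke i else rim i.

(* The triple with index i, cyclically rotated so that its parent comes first. *)
Definition rooted Y i :=
  if i \in Y then spoke i
  else if pr i \in Y then (un (pr i), pm i, un (pr (pr i))) else rim i.

Definition swap (b : bool) (x : vtx k * vtx k * vtx k) :=
  if b then (x.1.1, x.2, x.1.2) else x.

(** Tells whether w reverses the triple against the standard orientation. *)
Definition flip (w : {set vtx k} -> {perm vtx k}) x := w (tset x) != cyc x.

Definition lucas_tri w Y i := swap (flip w (element Y i)) (rooted Y i).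

Lemma tset_swap b x : tset (swap b x) = tset x.
Proof. by case: b => //; rewrite /tset /= setUAC. Qed.

Lemma tset_rooted Y i : tset (rooted Y i) = tset (element Y i).
Proof.
rewrite /rooted /element; case: ifP => // _; case: ifP => // _.
by apply/setP=> x; rewrite !inE; do 3!case: (x == _).
Qed.

Lemma un_pr_neq i : un (pr (pr i)) != un (pr i).
Proof. by rewrite (inj_eq un_inj) ord_pred_neq. Qed.

Lemma cyc_rooted b Y i : cyc (swap b (rooted Y i)) = cyc (swap b (element Y i)).
Proof.
rewrite /rooted /element; case: ifP => // _; case: ifP => // _.
have e := un_pr_neq i; case: b; rewrite /cyc /=; first by rewrite cycle3_rot // eq_sym.
by rewrite [RHS]cycle3_rot.
Qed.

Lemma element_distinct Y i : let: (a, b, c) := element Y i in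
  [&& a != b, a != c & b != c].
Proof. by rewrite /element; case: ifP => //= _; rewrite un_pr_neq. Qed.

Lemma element_triple Y i : tset (element Y i) \in triples H.
Proof.
rewrite /= /lucas_triples /element inE; case: ifP => _; apply/orP; [left|right];
  exact: imset_f.
Qed.

Lemma flipE w Y i : orientation H w ->
  w (tset (element Y i)) = cyc (swap (flip w (element Y i)) (element Y i)).
Proof.
move=> ow; rewrite /flip /swap; case: eqVneq => [->//|nw].
have [a [b [c [tE wE]]]] := ow _ (element_triple Y i).
have /andP[_] := triplesP (element_triple Y i).
have := element_distinct Y i; move: tE wE nw.
case: (element Y i) => -[p c'] d tE wE nw /and3P[pc pd cd].
rewrite {1}tE -setUA !cardsU1 cards1 !inE negb_or => abc.
have : [&& a != b, a != c & b != c].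
  by move: abc; case: (a == b); case: (a == c); case: (b == c).
case/and3P=> ab ac bc.
have [wc|wc] := cycle3_orient pc pd cd ab ac bc (esym tE).
  by case/eqP: nw; rewrite wE wc.
by rewrite wE wc.
Qed.

Lemma tset_lucas_tri w Y i : tset (lucas_tri w Y i) = tset (element Y i).
Proof. by rewrite tset_swap tset_rooted. Qed.

Lemma cyc_lucas_tri w Y i : orientation H w ->
  w (tset (lucas_tri w Y i)) = cyc (lucas_tri w Y i).
Proof. by move=> ow; rewrite tset_lucas_tri flipE // cyc_rooted. Qed.

Lemma lucas_tri_children w Y i :
  [:: (lucas_tri w Y i).1.2; (lucas_tri w Y i).2] =i [:: un (child Y i); pm i].
Proof.
move=> x; rewrite /lucas_tri /swap /rooted /child.
by case: (flip _ _); (case: ifP => _; [|case: ifP => _]); rewrite !inE /= ?orbF // orbC.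
Qed.

Lemma lucas_tri_cd w Y i : [/\ (lucas_tri w Y i).1.2 != hb,
  (lucas_tri w Y i).2 != hb & (lucas_tri w Y i).1.2 != (lucas_tri w Y i).2].
Proof.
rewrite /lucas_tri /swap /rooted.
by case: (flip _ _); (case: ifP => _; [|case: ifP => _]).
Qed.

Lemma lucas_tri_parent w Y i : (lucas_tri w Y i).1.1 =
  if i \in Y then hb else un (if pr i \in Y then pr i else pr (pr i)).
Proof.
rewrite /lucas_tri /swap /rooted.
by case: (flip _ _); (case: ifP => _; [|case: ifP => _]).
Qed.

Lemma lucas_tri_disjoint w Y i j x : injective (child Y) ->
  x \in [:: (lucas_tri w Y i).1.2; (lucas_tri w Y i).2] ->
  x \in [:: (lucas_tri w Y j).1.2; (lucas_tri w Y j).2] -> i = j.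
Proof.
move=> cI; rewrite !lucas_tri_children !inE.
by case/orP=> /eqP-> /orP[]/eqP// => [/un_inj/cI|/pm_inj].
Qed.

Lemma lucas_tree_list w Y s : orientation H w -> injective (child Y) ->
  uniq s -> s =i 'I_k -> grown hb (map (lucas_tri w Y) s) ->
  tree_list H w (lucas_tree Y) hb (map (lucas_tri w Y) s).
Proof.
move=> ow cI us sE gs; split=> //.
- move=> x; rewrite verts_map inE; case: x => [x|] //=.
  apply/hasP; case: x => i; last first.
    by exists i; rewrite ?sE // lucas_tri_children !inE eqxx orbT.
  have [c _ cK] := injF_bij cI; exists (c i); rewrite ?sE //.
  by rewrite lucas_tri_children cK !inE eqxx.
- apply: uniq_perm (enum_uniq _) (grown_uniq_tset gs) _ => t.
  rewrite mem_enum -map_comp; apply/imsetP/mapP=> -[i _ ->]; exists i;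
    by rewrite /= ?sE ?tset_lucas_tri.
- by move=> _ /mapP[i _ ->]; apply: cyc_lucas_tri.
Qed.

(** The rank h i is the number of steps down from i to the nearest element of Y. *)
Lemma exists_rank Y : Y != set0 -> exists h : 'I_k -> nat,
  forall i, if i \in Y then h i = 0 else h (pr i) < h i.
Proof.
case/set0Pn=> y yY.
have ex i : exists n, iter n pr i \in Y by have [n nE] := iter_pred i y; exists n; rewrite nE.
exists (fun i => ex_minn (ex i)) => i.
case: ex_minnP => n nY nmin; case: ifP => iY.
  by apply/eqP; rewrite -leqn0; apply: nmin.
case: n nY nmin => [|n] nY nmin; first by rewrite /= iY in nY.
by case: ex_minnP => m _; apply; rewrite -iterSr.
Qed.

Lemma child_setT : child [set: 'I_k] =1 id.
Proof. by move=> i; rewrite /child inE. Qed.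

(** All spokes hang at the hub, so any order will do and the rank can be constant. *)
Lemma grown_setT w s : uniq s -> grown hb (map (lucas_tri w setT) s).
Proof.
move=> us; apply: (@grown_map _ _ _ _ (fun=> 0)) => //.
- by elim: (s) => //= i s' ->; rewrite andbT; apply/allP.
- by move=> i _; apply: lucas_tri_cd.
- move=> i j _ _ x; apply: lucas_tri_disjoint.
  by apply: eq_inj (fun i => esym (child_setT i)); apply: inj_id.
- by move=> i _; left; rewrite lucas_tri_parent inE.
Qed.

Lemma grown_sparse w Y h s : sparse Y ->
  (forall i, if i \in Y then h i = 0 else h (pr i) < h i) ->
  uniq s -> s =i 'I_k -> pairwise (fun i j => h j <= h i) s ->
  grown hb (map (lucas_tri w Y) s).
Proof.
move=> sY hP us sE ps; apply: (@grown_map _ _ _ _ h) => //.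
- by move=> i _; apply: lucas_tri_cd.
- by move=> i j _ _ x; apply/lucas_tri_disjoint/child_inj.
move=> i _; rewrite lucas_tri_parent; have := hP i.
case: ifP => [_ _|iY hi]; first by left.
right; case: ifP => piY.
  exists (pr i); rewrite sE hi lucas_tri_children /child piY !inE eqxx; split=> //.
(* The parent is now i - 2, the child of the spoke i - 2 if that spoke is used, and otherwise of the
   rim triple i - 1. *)
have hpi := hP (pr i); rewrite piY in hpi.
have [ppiY|ppiY] := boolP (pr (pr i) \in Y).
  exists (pr (pr i)); rewrite sE (ltn_trans hpi hi) lucas_tri_children.
  by rewrite /child ppiY !inE eqxx.
exists (pr i); rewrite sE hi lucas_tri_children /child piY (negPf ppiY).
by rewrite !inE eqxx.
Qed.

Lemma sparse_order Y : sparse Y -> Y != set0 -> exists s : seq 'I_k,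
  [/\ uniq s, s =i 'I_k & forall w, grown hb (map (lucas_tri w Y) s)].
Proof.
move=> sY /exists_rank[h hP].
pose e := fun i j => h j <= h i.
have e_tr : transitive e by move=> j i l hij hjl; apply: leq_trans hjl hij.
have e_tot : total e by move=> i j; apply: leq_total.
have us : uniq (sort e (enum 'I_k)) by rewrite sort_uniq enum_uniq.
have sE : sort e (enum 'I_k) =i 'I_k by move=> i; rewrite mem_sort mem_enum.
exists (sort e (enum 'I_k)); split=> // w.
apply: grown_sparse hP _ _ _ => //.
by rewrite -sorted_pairwise // sort_sorted.
Qed.

(* m1 carries out the reversals, including one for each y in Y caused by the
   rotation of the rim triple y + 1; these cancel the |Y| transpositions in
   [child_perm Y]. *)
Lemma lucas_sgn w Y : orientation H w -> sparse Y -> Y != set0 ->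
  tree_sgn H w (lucas_tree Y) = (tree_sgn H w (lucas_tree setT) *
    (-1) ^+ ((\big[addb/false]_i (flip w (spoke i) (+) flip w (element Y i)))
             (+) ~~ odd k))%R.
Proof.
move=> ow sY Y0; have [s [us sE gY]] := sparse_order sY Y0.
pose x i := flip w (spoke i) (+) flip w (element Y i) (+) (pr i \in Y).
pose m1 := \prod_(i | x i) tperm (un i) (pm i).
pose m2 := extend un_inj (child_perm Y).
have m1u i : m1 (un i) = if x i then pm i else un i.
  rewrite /m1; case: ifP => xi.
    by rewrite (@prod_tperm_at _ _ un pm x i) ?tpermL // => j _ ji;
      rewrite /= ?andbT ?(inj_eq un_inj) ?(inj_eq pm_inj) eq_sym.
  rewrite (@prod_tperm_fix _ _ un pm x) // => j _ xj.
  by rewrite andbT (inj_eq un_inj); apply: contraFneq xi => ->.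
have m1p i : m1 (pm i) = if x i then un i else pm i.
  rewrite /m1; case: ifP => xi.
    by rewrite (@prod_tperm_at _ _ un pm x i) ?tpermR // => j _ ji;
      rewrite /= ?andbT ?(inj_eq un_inj) ?(inj_eq pm_inj) eq_sym.
  rewrite (@prod_tperm_fix _ _ un pm x) // => j _ xj.
  by rewrite /= (inj_eq pm_inj); apply: contraFneq xi => ->.
have m1h : m1 hb = hb by rewrite /m1 (@prod_tperm_fix _ _ un pm x).
have m2u i : m2 (un i) = un (child Y i) by rewrite /m2 extendE child_permE.
have m2out y : y \notin codom un -> m2 y = y by apply: extend_out.
have m2p i : m2 (pm i) = pm i by apply: m2out; apply/negP=> /codomP[].
have m2h : m2 hb = hb by apply: m2out; apply/negP=> /codomP[].
have tT : tree_list H w (lucas_tree setT) hb (map (lucas_tri w setT) s).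
  apply: lucas_tree_list (grown_setT _ us) => //.
  by apply: eq_inj (fun i => esym (child_setT i)); apply: inj_id.
have tY := lucas_tree_list ow (child_inj sY) us sE (gY w).
rewrite (tree_sgn_renames (s := m1 * m2) tT tY).
- congr (_ * _ ^+ nat_of_bool _)%R.
  rewrite odd_permM odd_extend odd_child_perm addbA; congr (_ (+) _).
  rewrite (big_morph (@odd_perm _) (@odd_permM _) (@odd_perm1 _)).
  rewrite big_mkcond /=.
  have -> : \big[addb/false]_i (if x i then odd_perm (tperm (un i) (pm i)) else false)
      = \big[addb/false]_i x i.
    by apply: eq_bigr => i _; rewrite odd_tperm; case: (x i).
  rewrite big_split /=; rewrite -[RHS]addbF -addbA; congr (_ (+) _).
  suff -> : \big[addb/false]_i (pr i \in Y) = odd #|Y| by rewrite addbb.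
  rewrite -sum1_card (big_morph odd oddD (erefl _)) [RHS]big_mkcond /=.
  rewrite [RHS](reindex_inj (@ord_pred_inj k)) /=.
  by apply: eq_bigr => i _; case: (pr i \in Y).
- by apply/subsetP=> y _; rewrite inE.
- by rewrite permM m1h m2h.
apply: renames_map => i _; rewrite !permM.
rewrite /lucas_tri /swap /rooted /element inE.
have xE : x i = flip w (spoke i) (+) flip w (element Y i) (+) (pr i \in Y) by [].
have cE : child Y i = if i \in Y then i else if pr i \in Y then pr (pr i) else pr i by [].
move: xE cE; rewrite /element; case: ifP => iY.
  have -> : pr i \in Y = false by apply/negbTE/sparseP'.
  by case: (flip w (spoke i)); rewrite /= ?m1u ?m1p => -> cE /=; rewrite ?m2u ?m2p cE.
by case: ifP => piY; case: (flip w (spoke i)); case: (flip w (rim i));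
  rewrite /= ?m1u ?m1p => -> cE /=; rewrite ?m2u ?m2p cE.
Qed.

End Lucas.

(** * Spanning trees, orientations and minors of the Lucas graph *)

Section LucasTrees.
Local Open Scope group_scope.
Variables (k : nat) (k2 : 1 < k).
Implicit Types (i j : 'I_k) (Y : {set 'I_k}) (S : {set {set vtx k}}).

Notation pr := (@ord_pred k).
Notation sc := (@ordS k).
Notation un := (@unprimed k).
Notation pm := (@primed k).
Notation hb := (@hub k).
Notation H := (lucas_graph k2).

Lemma mem_pm_element Y i j : (pm i \in tset (element Y j)) = (i == j).
Proof. by rewrite /element; case: ifP => _; rewrite !inE. Qed.

Lemma mem_hub_element Y j : (hb \in tset (element Y j)) = (j \in Y).
Proof. by rewrite /element; case: ifP => _; rewrite !inE. Qed.

Lemma mem_un_element Y i j : (un i \in tset (element Y j)) =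
  if j \in Y then i == j else (sc i == j) || (sc (sc i) == j).
Proof.
rewrite !(can2_eq (@ordSK k) (@ord_predK k)) /element.
by case: ifP => _; rewrite !inE ?orbF // orbC.
Qed.

(** The primed vertex determines the index, and the hub tells spokes from rim triples. *)
Lemma element_inj Y Y' i j : tset (element Y i) = tset (element Y' j) ->
  i = j /\ (i \in Y) = (i \in Y').
Proof.
move=> E; have ij : i = j.
  by apply/eqP; rewrite -(mem_pm_element Y') -E mem_pm_element.
by split=> //; rewrite -(mem_hub_element Y) E mem_hub_element ij.
Qed.

Lemma mem_lucas_tree Y Y' i :
  (tset (element Y' i) \in lucas_tree Y) = ((i \in Y') == (i \in Y)).
Proof.
apply/imsetP/eqP=> [[j _ /(@element_inj Y' Y)[]]//|iE].
by exists i => //; rewrite /element iE.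
Qed.

Lemma lucas_tree_inj : injective (@lucas_tree k).
Proof.
move=> Y Y' E; apply/setP=> i.
have := mem_lucas_tree Y' Y i; rewrite -E mem_lucas_tree eqxx.
by move/esym/eqP.
Qed.

Lemma element_spoke i : element setT i = spoke i.
Proof. by rewrite /element inE. Qed.

Lemma element_rim i : element set0 i = rim i.
Proof. by rewrite /element inE. Qed.

Lemma mem_spoke_tree Y i : (tset (spoke i) \in lucas_tree Y) = (i \in Y).
Proof. by rewrite -element_spoke mem_lucas_tree inE; case: (i \in Y). Qed.

Lemma mem_rim_tree Y i : (tset (rim i) \in lucas_tree Y) = (i \notin Y).
Proof. by rewrite -element_rim mem_lucas_tree inE; case: (i \in Y). Qed.

Lemma triples_lucasP t : t \in triples H ->
  exists i, t = tset (spoke i) \/ t = tset (rim i).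
Proof. by case/setUP=> /imsetP[i _ ->]; exists i; [left|right]. Qed.

Definition tree_set Y := (Y == setT) || (Y != set0) && sparse Y.

(** The standard orientation with the spokes in F reversed; the final value 1 is a default for sets
    that are not triples. *)
Definition lucas_orient (F : pred 'I_k) (t : {set vtx k}) : {perm vtx k} :=
  if [pick i | t == tset (spoke i)] is Some i then cyc (swap (F i) (spoke i))
  else if [pick i | t == tset (rim i)] is Some i then cyc (rim i) else 1.

Lemma lucas_orient_spoke F i :
  lucas_orient F (tset (spoke i)) = cyc (swap (F i) (spoke i)).
Proof.
rewrite /lucas_orient; case: pickP => [j|/(_ i)]; last by rewrite eqxx.
by rewrite -!element_spoke => /eqP/element_inj[->].
Qed.

Lemma lucas_orient_rim F i : lucas_orient F (tset (rim i)) = cyc (rim i).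
Proof.
rewrite /lucas_orient; case: pickP => [j|_].
  by rewrite -element_spoke -element_rim => /eqP/element_inj[_]; rewrite !inE.
case: pickP => [j|/(_ i)]; last by rewrite eqxx.
by rewrite -!element_rim => /eqP/element_inj[->].
Qed.

Lemma lucas_orientation F : orientation H (lucas_orient F).
Proof.
move=> t /triples_lucasP[i [->|->]]; last first.
  by rewrite lucas_orient_rim; exists (un (pr (pr i))), (un (pr i)), (pm i).
rewrite lucas_orient_spoke /swap; case: (F i).
  by exists hb, (pm i), (un i); rewrite /tset setUAC.
by exists hb, (un i), (pm i).
Qed.

Lemma flip_spoke F i : flip (lucas_orient F) (spoke i) = F i.
Proof.
rewrite /flip lucas_orient_spoke /swap; case: (F i); last by rewrite eqxx.
apply/eqP=> /permP/(_ hb); rewrite /cyc /= !cycle3_l //.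
Qed.

Lemma flip_rim F i : flip (lucas_orient F) (rim i) = false.
Proof. by rewrite /flip lucas_orient_rim eqxx. Qed.

Lemma spanning_lucas_tree Y : tree_set Y -> spanning_tree H (lucas_tree Y).
Proof.
move=> gY; pose w := lucas_orient pred0; have ow := lucas_orientation pred0.
have [s [us sE gs cI]] : exists s : seq 'I_k, [/\ uniq s, s =i 'I_k,
    grown hb (map (lucas_tri w Y) s) & injective (child Y)].
  case/orP: gY => [/eqP->|/andP[Y0 sY]].
    exists (enum 'I_k); split; rewrite ?enum_uniq //.
    - by move=> i; rewrite mem_enum.
    - exact/grown_setT/enum_uniq.
    - by apply: eq_inj (fun i => esym (child_setT i)); apply: inj_id.
  have [s [us sE gs]] := sparse_order sY Y0.
  by exists s; split=> //; apply: child_inj.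
have [_ vl pl _] := lucas_tree_list ow cI us sE gs.
apply: grown_spanning gs vl _ _.
- rewrite -size_eq0 size_map -(card_uniqP us) (eq_card sE) card_ord.
  by rewrite -lt0n (ltnW k2).
- by move=> t; rewrite -(perm_mem pl) mem_enum.
by apply/subsetP=> t /imsetP[i _ ->]; apply: element_triple.
Qed.

(** Two consecutive elements force their predecessor into Y, and so on around the whole cycle. *)
Lemma sparse_tree_set Y : Y != set0 ->
  (forall i, sc i \in Y -> sc (sc i) \in Y -> i \in Y) -> tree_set Y.
Proof.
move=> Y0 clY; rewrite /tree_set Y0 /=; apply/orP.
have [|/forallPn[i]] := boolP (sparse Y); first by right.
rewrite negbK => /andP[iY siY]; left; apply/eqP/setP=> j; rewrite inE.
have [n <-] := iter_pred i j.
suff /andP[] : (iter n pr i \in Y) && (sc (iter n pr i) \in Y) by [].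
elim: n => [|n /andP[nY snY]]; first by rewrite /= iY siY.
by rewrite /= ord_predK nY andbT; apply: clY; rewrite ord_predK.
Qed.

(** As 2 #|S| + 1 = 2k + 1, S has k triples; covering each i' takes one triple of each index, so
    exactly one. Covering the hub makes Y nonempty. The vertex i lies only in the spoke i and the
    rim triples i + 1 and i + 2, so if Y contains i + 1 and i + 2 it contains i. *)
Lemma spanning_lucas_treeP S : spanning_tree H S -> exists2 Y, S = lucas_tree Y & tree_set Y.
Proof.
move=> sS; have [SH _ cS _] := sS.
have cov x : exists2 t, t \in S & x \in t.
  have : x \in cover S by rewrite cS inE.
  by case/bigcupP=> t tS xt; exists t.
have [l [gl vl pl]] := spanning_grown sS (in_setT hb).
have Sk : #|S| = k.
  have : #|vtx k| = #|S|.*2.+1.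
    rewrite cardE (perm_size pl) size_map -(size_verts hb) -(card_uniqP (grown_uniq gl)).
    by rewrite (eq_card vl) cardsT.
  by rewrite card_option card_sum !card_ord => -[]; rewrite addnn => /double_inj.
pose Y := [set i | tset (spoke i) \in S].
have YS i : tset (element Y i) \in S.
  rewrite /element inE; case: ifP => // niS; have [t tS it] := cov (pm i).
  have [j tE] := triples_lucasP (subsetP SH _ tS).
  have ij : i = j.
    by apply/eqP; case: tE it => ->; rewrite -?element_spoke -?element_rim mem_pm_element.
  by move: tS; case: tE => ->; rewrite -ij // niS.
have SE : S = lucas_tree Y.
  apply/esym/eqP; rewrite eqEcard Sk; apply/andP; split.
    by apply/subsetP=> t /imsetP[i _ ->]; apply: YS.
  by rewrite card_imset ?cardsT ?card_ord // => i j /element_inj[].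
have covY x : exists j, x \in tset (element Y j).
  by have [t + xt] := cov x; rewrite SE => /imsetP[j _ tE]; exists j; rewrite -/(element Y j) -tE.
exists Y => //; apply: sparse_tree_set => [|i siY ssiY].
  have [j] := covY hb; rewrite mem_hub_element => jY.
  by apply/set0Pn; exists j.
have [j] := covY (un i); rewrite mem_un_element.
by case: ifP => [jY /eqP->//|jY /orP[]/eqP jE]; rewrite -jE ?siY ?ssiY in jY.
Qed.

(** A reversed spoke i changes the signs of both trees if i is in Y, and only that of the tree of
    Z/k otherwise. *)
Lemma lucas_orient_sgn F Y : sparse Y -> Y != set0 ->
  tree_sgn H (lucas_orient F) (lucas_tree Y) =
  (tree_sgn H (lucas_orient F) (lucas_tree setT) *
    (-1) ^+ ((\big[addb/false]_i (F i && (i \notin Y))) (+) ~~ odd k))%R.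
Proof.
move=> sY Y0; rewrite (lucas_sgn (lucas_orientation F) sY Y0).
congr (_ * _ ^+ nat_of_bool (_ (+) _))%R; apply: eq_bigr => i _.
rewrite /element flip_spoke; case: ifP => _; rewrite ?flip_spoke ?flip_rim.
  by rewrite addbb andbF.
by rewrite addbF andbT.
Qed.

Lemma lucas_orient_pred0 Y : sparse Y -> Y != set0 ->
  tree_sgn H (lucas_orient pred0) (lucas_tree Y) =
  (tree_sgn H (lucas_orient pred0) (lucas_tree setT) * (-1) ^+ ~~ odd k)%R.
Proof. by move=> sY Y0; rewrite lucas_orient_sgn // big1. Qed.

Lemma lucas_pfaffian_odd : odd k -> pfaffian3 H.
Proof.
move=> ok; exists (lucas_orient pred0); split; first exact: lucas_orientation.
suff same Y : tree_set Y -> tree_sgn H (lucas_orient pred0) (lucas_tree Y) =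
    tree_sgn H (lucas_orient pred0) (lucas_tree setT).
  by move=> S1 S2 /spanning_lucas_treeP[Y1 -> g1] /spanning_lucas_treeP[Y2 -> g2]; rewrite (same _ g1) (same _ g2).
case/orP=> [/eqP->//|/andP[Y0 sY]].
by rewrite lucas_orient_pred0 // ok GRing.mulr1.
Qed.

(** Avoiding a spoke excludes the tree of Z/k, and all other trees have equal signs in the standard
    orientation. *)
Lemma same_sign_off i S1 S2 : spanning_tree H S1 -> spanning_tree H S2 ->
  tset (spoke i) \notin S1 -> tset (spoke i) \notin S2 ->
  tree_sgn H (lucas_orient pred0) S1 = tree_sgn H (lucas_orient pred0) S2.
Proof.
move=> /spanning_lucas_treeP[Y1 -> g1] /spanning_lucas_treeP[Y2 -> g2].
have off Y : tree_set Y -> tset (spoke i) \notin lucas_tree Y -> sparse Y /\ Y != set0.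
  by rewrite mem_spoke_tree => /orP[/eqP->|/andP[]//]; rewrite inE.
move=> /(off _ g1)[s1 n1] /(off _ g2)[s2 n2].
by rewrite (lucas_orient_pred0 s1 n1) (lucas_orient_pred0 s2 n2).
Qed.

(* The reversed spoke i + 1 lies in only one tree containing the spoke i, the
   one with Y = Z/k. *)
Lemma same_sign_on i S1 S2 : ~~ odd k ->
  spanning_tree H S1 -> spanning_tree H S2 ->
  tset (spoke i) \in S1 -> tset (spoke i) \in S2 ->
  tree_sgn H (lucas_orient (pred1 (sc i))) S1 =
  tree_sgn H (lucas_orient (pred1 (sc i))) S2.
Proof.
move=> ek /spanning_lucas_treeP[Y1 -> g1] /spanning_lucas_treeP[Y2 -> g2].
suff same Y : tree_set Y -> tset (spoke i) \in lucas_tree Y ->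
    tree_sgn H (lucas_orient (pred1 (sc i))) (lucas_tree Y) =
    tree_sgn H (lucas_orient (pred1 (sc i))) (lucas_tree setT).
  by move=> i1 i2; rewrite (same _ g1 i1) (same _ g2 i2).
rewrite mem_spoke_tree => /orP[/eqP->//|/andP[Y0 sY] iY].
rewrite lucas_orient_sgn // (bigD1 (sc i)) //= eqxx (sparseP sY iY) big1.
  by rewrite ek GRing.mulr1.
by move=> j /negPf->.
Qed.

(* The trees given by Z/k, {1}, the other odd elements and the even elements
   contain every triple an even number of times in total, so the product of
   their signs does not depend on the orientation; it is -1 for even k. *)
Lemma lucas_not_pfaffian : ~~ odd k -> 3 < k -> ~ pfaffian3 H.
Proof.
move=> ek k4 [w [ow same]].
pose x Y i := flip w (spoke i) (+) flip w (element Y i).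
(* For even k the relative sign of the standard orientation is -1, so w must compensate by an odd
   number of reversals. *)
have sum1 Y : sparse Y -> Y != set0 -> \big[addb/false]_i x Y i = true.
  move=> sY Y0; have gT : tree_set setT by rewrite /tree_set eqxx.
  have gY : tree_set Y by rewrite /tree_set sY Y0 orbT.
  have sT := spanning_lucas_tree gT.
  have [l tl] := spanning_tree_list sT (in_setT hb) ow.
  have := same _ _ sT (spanning_lucas_tree gY); rewrite (lucas_sgn ow sY Y0) ek.
  have := tree_sgn_neq0 tl; move: (tree_sgn _ _ _) => z z0.
  rewrite -/(x Y); case: (\big[_/_]_i _) => //=; rewrite GRing.mulrN1 => /eqP.
  by rewrite -GRing.addr_eq0 -GRing.mulr2n Num.Theory.mulrn_eq0 /= (negPf z0).
pose odds := [set i : 'I_k | odd i].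
have odd_sc i : odd (sc i) = ~~ odd i by rewrite /= odd_mod // (negPf ek).
pose i0 : 'I_k := Ordinal (ltnW k2); pose i1 : 'I_k := Ordinal k2.
(* Since k is at least 4, the odd elements other than 1 include 3. *)
pose i3 : 'I_k := Ordinal k4.
have sO Y : Y \subset odds -> sparse Y.
  move=> /subsetP YO; apply/forallP=> i; apply/negP=> /andP[/YO + /YO].
  by rewrite !inE odd_sc => ->.
have s1 := sum1 [set i1]; have s2 := sum1 (odds :\ i1); have s3 := sum1 (~: odds).
(* Each i lies in exactly one of the three sets; its term there is zero and the other two cancel.
   But each of the three sums is true. *)
have : \big[addb/false]_i x [set i1] i (+) \big[addb/false]_i x (odds :\ i1) i
    (+) \big[addb/false]_i x (~: odds) i = false.
  rewrite -!big_split /= big1 // => i _; rewrite /x /element !inE.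
  have [->|_] := eqVneq i i1; last case: (odd i);
    by case: (flip w (spoke _)); case: (flip w (rim _)).
rewrite s1 ?s2 ?s3 //.
- by apply/forallP=> i; rewrite !inE odd_sc; case: (odd i).
- by apply/set0Pn; exists i0; rewrite !inE.
- exact/sO/subsetDl.
- by apply/set0Pn; exists i3; rewrite !inE.
- by apply: sO; rewrite sub1set inE.
- by apply/set0Pn; exists i1; rewrite !inE.
Qed.

(** Deleting one triple of index i and contracting the other thus concern the same trees of H, so
    two sign computations settle all four kinds of minors. *)
Lemma spoke_rim S i : spanning_tree H S ->
  (tset (spoke i) \in S) = (tset (rim i) \notin S).
Proof.
by case/spanning_lucas_treeP=> Y -> _; rewrite mem_spoke_tree mem_rim_tree negbK.
Qed.

Lemma lucas_minimal : ~~ odd k -> 3 < k -> minimal_non_pfaffian3 H.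
Proof.
move=> ek k4; split; first exact: lucas_not_pfaffian.
- move=> e /triples_lucasP[i [->|->]].
    exact: pfaffian_delete (lucas_orientation pred0) (@same_sign_off i).
  apply: pfaffian_delete (lucas_orientation (pred1 (sc i))) _ => S1 S2 t1 t2.
  by rewrite -!spoke_rim //; apply: same_sign_on.
move=> e a eH ae; have [i [eE|eE]] := triples_lucasP eH.
  apply: pfaffian_contract (lucas_orientation (pred1 (sc i))) _ => S1 S2 t1 t2.
  by rewrite eE; apply: same_sign_on.
apply: pfaffian_contract (lucas_orientation pred0) _ => S1 S2 t1 t2 e1 e2.
by apply: (@same_sign_off i) => //; rewrite spoke_rim // negbK -eE.
Qed.

(** Z/k, which is not sparse, takes the place of the empty set. *)
Lemma card_tree_set : #|[set Y : {set 'I_k} | tree_set Y]| = #|[set Y : {set 'I_k} | sparse Y]|.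
Proof.
have sT : ~~ sparse [set: 'I_k].
  by apply/negP=> /forallP/(_ (Ordinal (ltnW k2))); rewrite !inE.
have s0 : sparse (set0 : {set 'I_k}) by apply/forallP=> i; rewrite inE.
rewrite (cardsD1 setT) (cardsD1 set0 [set Y : {set 'I_k} | sparse Y]) !inE /tree_set eqxx s0 /=.
congr (_ + _)%N; apply: eq_card => Y; rewrite !inE.
have [->|_] := eqVneq Y setT; first by rewrite (negPf sT) andbF.
by [].
Qed.

Lemma card_spanning_trees : #|spanning_trees H| = #|[set Y : {set 'I_k} | sparse Y]|.
Proof.
rewrite -card_tree_set -(card_imset _ lucas_tree_inj); apply: eq_card => S.
rewrite inE; apply/asboolP/imsetP => [/spanning_lucas_treeP[Y -> gY]|[Y + ->]].
  by exists Y; rewrite ?inE.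
by rewrite inE; apply: spanning_lucas_tree.
Qed.

End LucasTrees.

(** * Counting *)

Definition nand : rel bool := fun a b => ~~ (a && b).

Fixpoint words n : seq (seq bool) :=
  if n is n'.+1 then map (cons false) (words n') ++ map (cons true) (words n')
  else [:: [::]].

Lemma mem_words n s : (s \in words n) = (size s == n).
Proof.
elim: n s => [|n IH] [|b s] //=; rewrite mem_cat; first by apply/negbTE/norP; split; apply/mapP=> -[].
rewrite eqSS -IH; apply/orP/idP => [[]/mapP[u us [_ ->]]//|sw].
by case: b; [right|left]; apply: map_f.
Qed.

Lemma words_uniq n : uniq (words n).
Proof.
elim: n => //= n IH; rewrite cat_uniq !map_inj_uniq ?IH //; try by move=> u v [].
by rewrite andbT; apply/hasPn=> _ /mapP[u _ ->]; apply/mapP=> -[].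
Qed.

(* Words s of length n such that no two consecutive letters of a s z are both
   true. *)
Definition paths n a z := count (fun s => path nand a (rcons s z)) (words n).

Lemma paths_false n z : paths n.+1 false z = paths n false z + paths n true z.
Proof. by rewrite /paths /= count_cat !count_map. Qed.

Lemma paths_true n z : paths n.+1 true z = paths n false z.
Proof.
rewrite /paths /= count_cat !count_map.
by rewrite [X in _ + X](eq_count (a2 := pred0)) // count_pred0 addn0.
Qed.

(** Both sides satisfy the Fibonacci recurrence, so two consecutive values are carried through the
    induction. *)
Lemma lucas_paths n : lucas n.+1 = paths n false false + paths n true true.
Proof.
have [] : lucas n.+1 = paths n false false + paths n true true /\
   lucas n.+2 = paths n.+1 false false + paths n.+1 true true; last by [].
elim: n => [|n [IH1 IH2]] //; split=> //.
rewrite -[LHS]/(lucas n.+2 + lucas n.+1) IH1 IH2.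
rewrite (paths_false n.+1) (paths_true n.+1) !paths_true !paths_false.
lia.
Qed.

(** A cyclic word is a path from its first letter back to that letter; the two summands correspond
    to the two possible first letters. *)
Lemma count_cycle_words n : count (path.cycle nand) (words n.+1) = lucas n.+1.
Proof. by rewrite lucas_paths /= count_cat !count_map. Qed.

Lemma card_sparse (k : nat) : 0 < k -> #|[set Y : {set 'I_k} | sparse Y]| = lucas k.
Proof.
case: k => // n _; rewrite -count_cycle_words.
pose f (Y : {set 'I_n.+1}) := [seq i \in Y | i <- enum 'I_n.+1].
have f_inj : injective f.
  move=> Y Y' /eq_in_map E; apply/setP=> i; apply: E; exact: mem_enum.
have nth_f Y (i : 'I_n.+1) : nth false (f Y) i = (i \in Y).
  by rewrite (nth_map i) ?size_enum_ord // nth_ord_enum.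
have size_f Y : size (f Y) = n.+1 by rewrite size_map size_enum_ord.
have fE Y : sparse Y = path.cycle nand (f Y).
  case E : (f Y) (size_f Y) => [//|x p] [szp].
  (* In the word closed up by its first letter x, the letter after position i is that of [ordS i],
     also at the last position, where it is the repeated x. *)
  have step (i : 'I_n.+1) : (nth false (x :: rcons p x) i = (i \in Y)) *
      (nth false (rcons p x) i = (ordS i \in Y)).
    split; first by rewrite -rcons_cons nth_rcons /= szp ltn_ord -E nth_f.
    rewrite -nth_f E nth_rcons szp /=.
    have [ilt|ige] := ltnP i n; first by rewrite modn_small.
    have -> : i = n :> nat by apply/eqP; rewrite eqn_leq ige -ltnS ltn_ord.
    by rewrite eqxx modnn.
  apply/forallP/(pathP false) => [sY i|pY i].
    rewrite size_rcons szp => ilt; have [/= -> ->] := step (Ordinal ilt).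
    exact: sY.
  by have := pY i; rewrite size_rcons szp ltn_ord !step => /(_ isT).
rewrite -size_filter cardE -(size_map f).
apply/perm_size/uniq_perm => [||s].
- by rewrite map_inj_uniq ?enum_uniq.
- exact/filter_uniq/words_uniq.
rewrite mem_filter mem_words.
apply/mapP/andP => [[Y + ->]|[cs /eqP sz]].
  by rewrite mem_enum inE fE size_f.
have sE : s = f [set i : 'I_n.+1 | nth false s i].
  apply: (@eq_from_nth _ false) => [|i]; rewrite ?size_f // sz => ilt.
  by rewrite -[i]/(val (Ordinal ilt)) nth_f inE.
by exists [set i : 'I_n.+1 | nth false s i] => //; rewrite mem_enum inE fE -sE.
Qed.

Theorem theorem6p4 (k : nat) (k2 : 2 <= k) :
  [/\ #|spanning_trees (lucas_graph k2)| = lucas k,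
      odd k -> pfaffian3 (lucas_graph k2),
      ~~ odd k -> 4 <= k -> ~ pfaffian3 (lucas_graph k2) &
      ~~ odd k -> 4 <= k -> minimal_non_pfaffian3 (lucas_graph k2)].
Proof.
split.
- by rewrite card_spanning_trees card_sparse // ltnW.
- exact: lucas_pfaffian_odd.
- exact: lucas_not_pfaffian.
- exact: lucas_minimal.
Qed.
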